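(* Let $\pi:[0,1]^d\to[0,1]$ be a fixed (pre-trained) measurable working model and write $\mathrm{score}(\bm{x})=1-\pi(\bm{x})$. Assume that: (1) there exists a constant $c_0>0$ such that $|\Pr(Y=1\mid\bm{x})-p_R|\ge c_0$ for almost every $\bm{x}\in[0,1]^d$; (2) $\Pr(Y=1\mid\bm{x})=g(\mathrm{score}(\bm{x}))$ for some measurable function $g$, and there is an interval $[c_-^*,c_+^*]\subseteq[0,1]$ (possibly a single point, $c_-^*=c_+^*$) such that $$\bigl(p_R-\mathbb{E}\{\Pr(Y=1\mid\bm{x})\mid\mathrm{score}(\bm{x})=u\}\bigr)(u-c_+^* )>0\quad\text{for almost every }u\in[0,1]\setminus[c_-^*,c_+^*];$$ (3) for $\bm{Z}$ uniformly distributed on $[0,1]^d$ and the same interval $[c_-^*,c_+^*]$, the variable $\mathrm{score}(\bm{Z})$ has a density $f_{\mathrm{score}}$ which is continuous on $[0,c_-^* )$ and on $(c_+^*,1]$, and there is a constant $c>0$ such that $c^{-1}\le f_{\mathrm{score}}(u)\le c$ for a.e. $u\in[0,1]\setminus[c_-^*,c_+^*]$ and $f_{\mathrm{score}}(u)=0$ for a.e. $u\in[c_-^*,c_+^*]$. Assume further that the data $(\bm{x}_1,Y_1),\dots,(\bm{x}_{n_{\mathrm{cal}}},Y_{n_{\mathrm{cal}}}),(\bm{x}_{n_{\mathrm{cal}}+1},Y_{n_{\mathrm{cal}}+1})$ are i.i.d. Let $\alpha>0$, let $\widehat{\lambda}^*_{n_{\mathrm{cal}}}$ be a minimizer of $\mathscr{L}_{n_{\mathrm{cal}}}(\lambda)$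 over $\lambda\in[0,1]$, and let $$\widehat{\lambda}^\dagger_{n_{\mathrm{cal}}}=\sup\Bigl\{\lambda\in[\widehat{\lambda}^*_{n_{\mathrm{cal}}},1]\;:\;\frac{n_{\mathrm{cal}}}{n_{\mathrm{cal}}+1}\sup_{\widehat{\lambda}^*_{n_{\mathrm{cal}}}\le\gamma\le\lambda}\mathscr{L}_{n_{\mathrm{cal}}}(\gamma)+\frac1{n_{\mathrm{cal}}+1}-\mathscr{L}_{n_{\mathrm{cal}}}(\widehat{\lambda}^*_{n_{\mathrm{cal}}})\le\alpha\Bigr\},$$ with $\widehat{\lambda}^\dagger_{n_{\mathrm{cal}}}=-1$ if this set is empty. Then $$\limsup_{n_{\mathrm{cal}}\to\infty}\mathbb{E}\{\mathcal{R}_1(\widehat{\lambda}^\dagger_{n_{\mathrm{cal}}})\}=\limsup_{n_{\mathrm{cal}}\to\infty}\mathbb{E}\Bigl\{\ell(\widehat{\lambda}^\dagger_{n_{\mathrm{cal}}},\bm{x}_{n_{\mathrm{cal}}+1},Y_{n_{\mathrm{cal}}+1})-\min_{\lambda}\mathbb{E}\{\mathscr{L}_{n_{\mathrm{cal}}}(\lambda)\}\Bigr\}\le\alpha.$$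
   Context: The pair $(\bm{x},Y)$ is random: $\bm{x}$ is uniformly distributed on $[0,1]^d$ and, given $\bm{x}$, $Y\in\{0,1\}$ is Bernoulli with success probability $\Pr(Y=1\mid\bm{x})$; all pairs $(\bm{x}_i,Y_i)$ have this distribution. For a fixed $p_R\in(0,1)$ the reliability set is $\mathcal{X}_R=\{\bm{x}\in[0,1]^d : \Pr(Y=1\mid\bm{x})\ge p_R\}$. It is assumed that $\mathcal{X}_R$ and its complement both have positive Lebesgue measure and that $\{\bm{x}:\Pr(Y=1\mid\bm{x})=p_R\}$ has Lebesgue measure zero. For a scalar $\lambda$ put $\hat{\mathcal{X}}_R(\lambda)=\{\bm{x}\in[0,1]^d:\pi(\bm{x})\ge 1-\lambda\}$. The loss is $\ell(\lambda,\bm{x},Y)=\mathbb{I}(\pi(\bm{x})\ge 1-\lambda,\,Y=0)+(1-p_R)\,\mathbb{I}(\pi(\bm{x})<1-\lambda)$, the empirical loss is $\mathscr{L}_{n_{\mathrm{cal}}}(\lambda)=\frac1{n_{\mathrm{cal}}}\sum_{i=1}^{n_{\mathrm{cal}}}\ell(\lambda,\bm{x}_i,Y_i)$, and $\min_\lambda$ is over $\lambda\in[0,1]$. For a threshold $\lambda$ computed from the calibration data $(\bm{x}_i,Y_i)$, $i\le n_{\mathrm{cal}}$, the expected type I risk is $$\mathbb{E}\{\mathcal{R}_1(\lambda)\}=\mathbb{E}\bigl\{(p_R-Y_{n_{\mathrm{cal}}+1})\,\mathbb{I}(\bm{x}_{n_{\mathrm{cal}}+1}\in\hat{\mathcal{X}}_R(\lambda),\,\bm{x}_{n_{\mathrm{cal}}+1}\notin\mathcal{X}_R)\bigr\},$$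 the expectation being over both the calibration data and the test pair. *)

(* Defs.v *)
From HB Require Import structures.
From mathcomp Require Import all_boot all_order all_algebra.
From mathcomp Require Import all_classical all_reals all_analysis.

Set Implicit Arguments.
Unset Strict Implicit.
Unset Printing Implicit Defensive.

Import Order.TTheory GRing.Theory Num.Theory.
Import numFieldNormedType.Exports.

Local Open Scope classical_set_scope.
Local Open Scope ring_scope.

Section product_power.
Context {dT : measure_display} {T : measurableType dT} {R : realType}.

Definition cons_pair n (p : T * n.-tuple T) : n.+1.-tuple T :=
  [tuple of p.1 :: p.2].

Lemma measurable_cons_pair n :
  measurable_fun [set: T * n.-tuple T] (@cons_pair n).
Proof. by apply: measurable_cons. Qed.

HB.instance Definition _ n :=
  isMeasurableFun.Build _ _ _ _ (@cons_pair n) (@measurable_cons_pair n).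

Fixpoint power_prob (mu : probability T R) n : probability (n.-tuple T) R :=
  match n return probability (n.-tuple T) R with
  | 0 => dirac ([tuple] : 0.-tuple T)
  | n'.+1 => distribution (mu \x power_prob mu n')%E (@cons_pair n')
  end.

(* This characterizes power_prob as the n-fold product measure. *)
Lemma power_prob_box (mu : probability T R) n (A : 'I_n -> set T) :
  (forall i, measurable (A i)) ->
  power_prob mu n [set x | forall i, A i (tnth x i)]
  = (\prod_(i < n) mu (A i))%E.
Proof.
elim: n A => [|n IH] A mA.
  rewrite big_ord0 /= diracE mem_set//=; by case.
rewrite big_ord_recl /= /distribution /pushforward.
have mB : measurable
    [set x : n.-tuple T | forall i, A (lift ord0 i) (tnth x i)].
  rewrite (_ : [set _ | _] =
    \bigcap_(i in [set: 'I_n]) ((@tnth n T)^~ i @^-1` A (lift ord0 i))).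
    apply: fin_bigcap_measurable => // i _.
    rewrite -[X in measurable X]setTI.
    by apply: measurable_tnth => //; exact: mA.
  by apply/seteqP; split => [x h i _|x h i]; [exact: h|exact: (h i)].
rewrite -[in RHS](IH (fun i => A (lift ord0 i)))// -product_measure1E//.
congr (_ _); apply/seteqP; split => [[t x]/= h|[t x]/= [h0 h] i].
  split => /=; first by have := h ord0; rewrite (tnth_nth t).
  move=> i; have := h (lift ord0 i); by rewrite tnthS.
have [j ->|->] := unliftP ord0 i; first by rewrite tnthS.
by rewrite (tnth_nth t).
Qed.

End product_power.

Section uniform_cube.
Context (R : realType) (d : nat).

Definition unit_cube : set (d.-tuple R) :=
  [set x | forall i, 0 <= tnth x i <= 1].

(* uniform_prob is a measure on measurableTypeR R; it is transported along the
   identity to R itself, which carries the same Borel sigma-algebra. *)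
Definition to_R (t : measurableTypeR R) : R := t.

Lemma measurable_to_R : measurable_fun [set: measurableTypeR R] to_R.
Proof. by move=> _ B mB; rewrite setTI. Qed.

HB.instance Definition _ :=
  isMeasurableFun.Build _ _ _ _ to_R measurable_to_R.

Definition uniform01 : probability R R :=
  distribution (uniform_prob (@ltr01 R)) to_R.

(* The product of d copies of Lebesgue measure restricted to [0, 1], that is,
   d-dimensional Lebesgue measure restricted to [0, 1]^d.  It plays both the
   role of the uniform law and that of Lebesgue measure on the cube. *)
Definition uniform_cube : probability (d.-tuple R) R := power_prob uniform01 d.

End uniform_cube.

Section probability_notions.
Context {dO : measure_display} {Omega : measurableType dO} {R : realType}.
Context {dU : measure_display} {U : measurableType dU}.
Variable P : probability Omega R.

Definition iid (Z : nat -> Omega -> U) : Prop :=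
  (forall i (A : set U), measurable A -> P (Z i @^-1` A) = P (Z 0%N @^-1` A)) /\
  (forall n (A : 'I_n -> set U), (forall i, measurable (A i)) ->
    P [set w | forall i : 'I_n, A i (Z i w)]
    = (\prod_(i < n) P (Z i @^-1` A i))%E).

(* m is a version of u |-> E[V | S = u]; D is a set containing all values of S,
   outside of which m is unconstrained. *)
Definition cond_expectation_given (D : set U) (S : Omega -> U) (V : Omega -> R)
    (m : U -> R) : Prop :=
  measurable_fun D m /\
  forall B : set U, measurable B -> B `<=` D ->
    (\int[P]_(w in S @^-1` B) (V w)%:E
     = \int[P]_(w in S @^-1` B) (m (S w))%:E)%E.

End probability_notions.

Definition has_density {R : realType} (law : set R -> \bar R) (f : R -> R) : Prop :=
  [/\ measurable_fun setT f, (forall u, 0 <= f u) &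
      forall B : set R, measurable B ->
        law B = (\int[lebesgue_measure]_(u in B) (f u)%:E)%E].

Section reliability.
Context {R : realType} {d : nat}.
Implicit Types (eta pi : d.-tuple R -> R) (pR lam alpha : R).

Definition reliability_set eta pR : set (d.-tuple R) :=
  [set x | unit_cube x /\ pR <= eta x].

Definition score pi (x : d.-tuple R) : R := 1 - pi x.

Definition estimated_set pi lam : set (d.-tuple R) :=
  [set x | unit_cube x /\ 1 - lam <= pi x].

(* Y in {0, 1} is encoded as a boolean, with true for 1. *)
Definition loss pR pi lam (x : d.-tuple R) (y : bool) : R :=
  ((1 - lam <= pi x)%R && ~~ y)%:R + (1 - pR) * (pi x < 1 - lam)%R%:R.

Definition empirical_loss pR pi n (z : n.-tuple (d.-tuple R * bool)) lam : R :=
  n%:R^-1 * \sum_(i < n) loss pR pi lam (tnth z i).1 (tnth z i).2.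

Definition type1_integrand eta pi pR lam (x : d.-tuple R) (y : bool) : R :=
  (pR - y%:R) * \1_(estimated_set pi lam `&` ~` reliability_set eta pR) x.

End reliability.

Section thresholds.
Context {R : realType}.

Definition minimizes01 (L : R -> R) (l : R) : Prop :=
  0 <= l <= 1 /\ forall lam, 0 <= lam <= 1 -> L l <= L lam.

(* The infimum over [0, 1]; it is the minimum whenever that is attained. *)
Definition min01 (L : R -> R) : R := inf [set L lam | lam in `[0, 1]].

Definition dagger_candidates (n : nat) (alpha : R) (L : R -> R) (l : R) : set R :=
  [set lam | l <= lam <= 1 /\
     n%:R / n.+1%:R * sup [set L gam | gam in `[l, lam]] + n.+1%:R^-1 - L l
     <= alpha].

Definition lambda_dagger (n : nat) (alpha : R) (L : R -> R) (l : R) : R :=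
  if dagger_candidates n alpha L l == set0 then -1
  else sup (dagger_candidates n alpha L l).

End thresholds.

Definition calibration {dO : measure_display} {Omega : measurableType dO}
    {R : realType} {d : nat} (X : nat -> Omega -> d.-tuple R)
    (Y : nat -> Omega -> bool) (n : nat) (w : Omega) :
    n.-tuple (d.-tuple R * bool) :=
  [tuple (X i w, Y i w) | i < n].

(* Main.v *)
Require Import Defs.
From HB Require Import structures.
From mathcomp Require Import all_boot all_order all_algebra.
From mathcomp Require Import all_classical all_reals all_analysis.
From mathcomp Require Import measurable_realfun lra ring.

Set Implicit Arguments.
Unset Strict Implicit.
Unset Printing Implicit Defensive.

Import Order.TTheory GRing.Theory Num.Theory.
Import numFieldNormedType.Exports.

Local Open Scope classical_set_scope.
Local Open Scope ring_scope.

(** The loss of a threshold lam at (x, y) is 1 - pR plus the gain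
    (pR - y) * [score x <= lam], so everything is governed by the mean gain
    H lam = E ((pR - Y) [score x <= lam]).  The increments of H are integrals of
    pR - eta x over slices of the score.  As eta x is a function of the score, it
    equals m (score x) almost surely ([cond_expectation_ae]), and the crossing
    condition, together with the absence of scores between cm and cp, gives
    pR - eta x the sign of score x - cp.  Hence H decreases up to cp and increases from cp on
    ([mean_gain_crossing]); the minimal mean loss is 1 - pR + H cp, and the points
    outside the reliability set are almost surely those with score above cp.

    Let D be a measurable bound on the uniform distance between the empirical loss
    and its mean.  It can be chosen so that its mean tends to 0
    ([empirical_loss_uniform_law]): this is a Glivenko-Cantelli argument, which uses
    that the law of the score has a bounded density.  The calibrated threshold is computed from the first n observations, so it is
    independent of the test observation; the expected excess loss is then
    E (H dagger) - H cp, and the expected type I risk is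
    E (H dagger) - E (H (min cp dagger)) ([gain_independent_threshold]).

    Two deterministic inequalities conclude ([lambda_dagger_excess]).  First,
    H dagger - H cp <= alpha + 2 D, because a candidate threshold exceeds the
    minimal empirical loss by at most alpha; this gives the bound by alpha.  Second,
    H (min cp dagger) - H cp <= 2 D: the calibrated threshold is not below the
    empirical minimizer, whose mean loss is nearly minimal, and H decreases up to
    cp.  So the excess loss and the type I risk differ by at most 2 E D, and have the
    same limit superior.

    Independence and Fubini's theorem require the calibrated threshold to be a
    measurable function of the sample.  The empirical loss only jumps at observed
    scores, so that the threshold is a finite minimum over these
    ([lambda_dagger_first_overrun], [measurable_lambda_dagger]). *)

(** * Expectations of bounded measurable functions *)

Section bounded_expectation.
Context {dO : measure_display} {Omega : measurableType dO} {R : realType}.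
Implicit Types (h : Omega -> R) (P : probability Omega R).

(** Every random variable of the proof is bounded, so integrability is a closure
    property of this class instead of a side condition at each use of linearity. *)
Definition bounded_mfun h :=
  measurable_fun [set: Omega] h /\ exists M, forall w, `|h w| <= M.

Lemma bounded_mfun_integrable P h :
  bounded_mfun h -> P.-integrable [set: Omega] (EFin \o h).
Proof.
move=> [mh [M hM]]; apply: measurable_bounded_integrable => //.
  by rewrite -ge0_fin_numE// fin_num_measure.
by exists M; split; [exact: num_real|move=> x Mx w _ /=; rewrite (le_trans (hM w)) ?ltW].
Qed.

Lemma bounded_mfun_cst (k : R) : bounded_mfun (fun=> k).
Proof. by split; [exact: measurable_cst|exists `|k|]. Qed.

Lemma bounded_mfunD h1 h2 :
  bounded_mfun h1 -> bounded_mfun h2 -> bounded_mfun (fun w => h1 w + h2 w).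
Proof.
move=> [m1 [M1 b1]] [m2 [M2 b2]]; split; first exact: measurable_funD.
by exists (M1 + M2) => w; rewrite (le_trans (ler_normD _ _))// lerD.
Qed.

Lemma bounded_mfunM h1 h2 :
  bounded_mfun h1 -> bounded_mfun h2 -> bounded_mfun (fun w => h1 w * h2 w).
Proof.
move=> [m1 [M1 b1]] [m2 [M2 b2]]; split; first exact: measurable_funM.
by exists (M1 * M2) => w; rewrite normrM ler_pM.
Qed.

Lemma bounded_mfunN h : bounded_mfun h -> bounded_mfun (fun w => - h w).
Proof.
move=> [mh [M b]]; split; first exact: measurable_funN.
by exists M => w; rewrite normrN.
Qed.

Lemma bounded_mfunB h1 h2 :
  bounded_mfun h1 -> bounded_mfun h2 -> bounded_mfun (fun w => h1 w - h2 w).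
Proof. by move=> b1 b2; apply: bounded_mfunD => //; exact: bounded_mfunN. Qed.

Lemma bounded_mfun_norm h : bounded_mfun h -> bounded_mfun (fun w => `|h w|).
Proof.
move=> [mh [M b]]; split; first exact: measurableT_comp.
by exists M => w; rewrite normr_id.
Qed.

Lemma bounded_mfun_sum (I : Type) (r : seq I) (F : I -> Omega -> R) :
  (forall i, bounded_mfun (F i)) -> bounded_mfun (fun w => \sum_(i <- r) F i w).
Proof.
move=> bF; elim: r => [|i r IH].
  under eq_fun do rewrite big_nil; exact: bounded_mfun_cst.
by under eq_fun do rewrite big_cons; exact: bounded_mfunD.
Qed.

Lemma bounded_mfun_bool (b : Omega -> bool) :
  measurable_fun [set: Omega] b -> bounded_mfun (fun w => (b w)%:R).
Proof.
move=> mb; split.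
  rewrite (_ : (fun w => (b w)%:R) = (fun w => if b w then 1 else 0)); last first.
    by apply/funext => w; case: (b w).
  exact: measurable_fun_ifT.
by exists 1 => w; case: (b w); rewrite ?normr1 ?normr0 ?ler01.
Qed.

Lemma measurable_set_of_bool (b : Omega -> bool) :
  measurable_fun [set: Omega] b -> measurable [set w | b w].
Proof.
move=> mb; have := mb measurableT _ (_ : measurable [set true]).
by rewrite setTI; exact.
Qed.

Lemma expectation_Rintegral P h :
  bounded_mfun h -> ('E_P[h] = (\int[P]_w h w)%R%:E)%E.
Proof.
move=> bh; rewrite unlock /Rintegral fineK//.
exact/integrable_fin_num/bounded_mfun_integrable.
Qed.

Lemma Rintegral_sum P (I : Type) (r : seq I) (F : I -> Omega -> R) :
  (forall i, bounded_mfun (F i)) ->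
  \int[P]_w \sum_(i <- r) F i w = \sum_(i <- r) \int[P]_w F i w.
Proof.
move=> bF; elim: r => [|i r IH].
  under eq_Rintegral do rewrite big_nil.
  by rewrite Rintegral_cst// mul0r big_nil.
under eq_Rintegral do rewrite big_cons.
rewrite RintegralD//; last 2 first.
- exact/bounded_mfun_integrable.
- exact/bounded_mfun_integrable/bounded_mfun_sum.
by rewrite IH big_cons.
Qed.

Lemma Rintegral_probability_cst P (k : R) : \int[P]_w k = k.
Proof.
rewrite Rintegral_cst// [X in fine X](_ : _ = 1%E) ?mulr1//.
exact: probability_setT.
Qed.

Lemma le_Rintegral_bounded P h1 h2 : bounded_mfun h1 -> bounded_mfun h2 ->
  (forall w, h1 w <= h2 w) -> \int[P]_w h1 w <= \int[P]_w h2 w.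
Proof. by move=> b1 b2 h12; apply: le_Rintegral => //; exact: bounded_mfun_integrable. Qed.

Lemma norm_Rintegral_bound P h (M : R) : measurable_fun [set: Omega] h ->
  (forall w, `|h w| <= M) -> `|\int[P]_w h w| <= M.
Proof.
move=> mh hM; have bh : bounded_mfun h by split => //; exists M.
rewrite (le_trans (le_normr_Rintegral measurableT (bounded_mfun_integrable P bh)))//.
rewrite -[leRHS](Rintegral_probability_cst P); apply: le_Rintegral_bounded => //.
  exact: bounded_mfun_norm.
exact: bounded_mfun_cst.
Qed.

Lemma Rintegral_indicator P (b : Omega -> bool) : measurable_fun [set: Omega] b ->
  \int[P]_w (b w)%:R = fine (P [set w | b w]).
Proof.
move=> mb; rewrite /Rintegral; congr fine.
rewrite -(setIT [set w | b w]) -integral_indic//; last exact: measurable_set_of_bool.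
apply: eq_integral => w _; rewrite indicE; congr (_%:R%:E).
by case bw : (b w); [rewrite mem_set|rewrite memNset//= bw].
Qed.

End bounded_expectation.

Lemma ae_imply {d0} {T0 : semiRingOfSetsType d0} {R : realFieldType}
    (mu : set T0 -> \bar R) (Q Q' : T0 -> Prop) : (forall u, Q u -> Q' u) ->
  {ae mu, forall u, Q u} -> {ae mu, forall u, Q' u}.
Proof.
move=> QQ' [N [mN N0 QN]]; exists N; split => // u /= nQ'.
by apply: QN => /= /QQ'.
Qed.

(** The integrand is almost surely its own absolute value. *)
Lemma Rintegral_ae_ge0 {dO} {Omega : measurableType dO} {R : realType}
    (P : probability Omega R) (h : Omega -> R) :
  bounded_mfun h -> {ae P, forall w, 0 <= h w} -> 0 <= \int[P]_w h w.
Proof.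
move=> bh h0; rewrite /Rintegral.
rewrite (@ae_eq_integral _ _ _ P setT (fun w => `|h w|%:E))//.
- by apply: fine_ge0; apply: integral_ge0 => w _; rewrite lee_fin.
- by apply/measurable_EFinP; have [] := bh.
- by apply/measurable_EFinP; have [] := bounded_mfun_norm bh.
- by apply: ae_imply h0 => w hw _; rewrite /= ger0_norm.
Qed.

Lemma Rintegral_ae_eq {dO} {Omega : measurableType dO} {R : realType}
    (P : probability Omega R) (h1 h2 : Omega -> R) :
  bounded_mfun h1 -> bounded_mfun h2 -> {ae P, forall w, h1 w = h2 w} ->
  \int[P]_w h1 w = \int[P]_w h2 w.
Proof.
move=> [m1 _] [m2 _] h12; rewrite /Rintegral; congr fine.
apply: ae_eq_integral => //; try exact/measurable_EFinP.
by apply: ae_imply h12 => w h _; rewrite /= h.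
Qed.

(** * Independence and Fubini's theorem *)

Section independence.
Context {dO : measure_display} {Omega : measurableType dO} {R : realType}.
Context {dU : measure_display} {U : measurableType dU}.
Context {dT : measure_display} {T : measurableType dT}.
Variable P : probability Omega R.

Definition independent_mfun (V : Omega -> U) (W : Omega -> T) :=
  forall A B, measurable A -> measurable B ->
  P (V @^-1` A `&` W @^-1` B) = (P (V @^-1` A) * P (W @^-1` B))%E.

(** The product rule on rectangles determines the joint law of (V, W), which is
    thus the product of the marginal laws; Fubini's theorem then integrates over
    W with the value of V held fixed. *)
Lemma independent_expectation (V : Omega -> U) (W : Omega -> T)
    (phi : U * T -> R) :
  measurable_fun [set: Omega] V -> measurable_fun [set: Omega] W ->
  independent_mfun V W -> bounded_mfun phi ->
  bounded_mfun (fun u => \int[P]_w phi (u, W w)) /\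
  \int[P]_w phi (V w, W w) = \int[P]_w' \int[P]_w phi (V w', W w).
Proof.
move=> mV mW indep bphi; have [mphi [M phiM]] := bphi.
pose V' : {mfun Omega >-> U} := HB.pack V (isMeasurableFun.Build _ _ _ _ V mV).
pose W' : {mfun Omega >-> T} := HB.pack W (isMeasurableFun.Build _ _ _ _ W mW).
have mVW : measurable_fun [set: Omega] (fun w => (V w, W w)).
  exact: measurable_fun_pair.
pose PV := distribution P V'; pose PW := distribution P W'.
have bphi1 u : bounded_mfun (fun t => phi (u, t)).
  by split; [exact: measurableT_comp|exists M].
have PWE u : (\int[PW]_t (phi (u, t))%:E)%E = (\int[P]_w phi (u, W w))%:E.
  rewrite integral_pushforward//=.
  - rewrite fineK//; apply: integrable_fin_num => //.
    apply: bounded_mfun_integrable; split => //.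
      exact: (measurableT_comp (bphi1 u).1).
    by exists M.
  - exact/measurable_EFinP/(bphi1 u).1.
  - apply: (@bounded_mfun_integrable _ _ _ _ (fun w => phi (u, W w))); split.
      exact: (measurableT_comp (bphi1 u).1).
    by exists M.
have mI : measurable_fun [set: U] (fun u => \int[P]_w phi (u, W w)).
  apply/measurable_EFinP.
  rewrite (_ : _ \o _ = fubini_F PW (EFin \o phi)); last first.
    by apply/funext => u; rewrite /fubini_F /= PWE.
  apply: (@measurable_fubini_F _ _ _ _ _ PV PW).
  exact: bounded_mfun_integrable.
have bI : bounded_mfun (fun u => \int[P]_w phi (u, W w)).
  split=> //; exists M => u; apply: norm_Rintegral_bound => //.
  exact: (measurableT_comp (bphi1 u).1).
split=> //.
rewrite {1}/Rintegral; congr fine.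
transitivity (\int[pushforward P (fun w => (V w, W w))]_z (phi z)%:E)%E.
  rewrite integral_pushforward//=.
  - exact/measurable_EFinP.
  - apply: (@bounded_mfun_integrable _ _ _ _ (fun w => phi (V w, W w))); split.
      exact: measurableT_comp.
    by exists M.
have joint : forall X, measurable X ->
    (PV \x PW)%E X = pushforward P (fun w => (V w, W w)) X.
  apply: product_measure_unique => A B mA mB.
  rewrite /pushforward/= -indep//.
transitivity (\int[(PV \x PW)%E]_z (phi z)%:E)%E.
  by apply: eq_measure_integral => A mA _; exact/esym/joint.
rewrite -(@integral12_prod_meas1 _ _ _ _ _ PV PW (EFin \o phi)); last first.
  exact: bounded_mfun_integrable.
rewrite /fubini_F/=.
under eq_integral do rewrite PWE.
rewrite integral_pushforward//=.
- exact/measurable_EFinP.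
- apply: (@bounded_mfun_integrable _ _ _ _ (fun w => \int[P]_w' phi (V w, W w'))).
  split; first exact: (measurableT_comp mI).
  by have [_ [M' hM']] := bI; exists M' => w.
Qed.

End independence.

(** * Independent identically distributed samples *)

Section iid_samples.
Context {dO : measure_display} {Omega : measurableType dO} {R : realType}.
Context {dT : measure_display} {T : measurableType dT}.
Variables (P : probability Omega R) (Z : nat -> Omega -> T).
Hypotheses (mZ : forall i, measurable_fun [set: Omega] (Z i)) (iidZ : iid P Z).

Definition sample n w : n.-tuple T := [tuple Z i w | i < n].

Lemma measurable_sample n : measurable_fun [set: Omega] (sample n).
Proof.
apply/measurable_fun_tnthP => i.
by rewrite (_ : _ \o _ = Z i)//; apply/funext => w; rewrite /= tnth_mktuple.
Qed.

Let box n : set (set (n.-tuple T)) :=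
  [set B | exists A : 'I_n -> set T, (forall i, measurable (A i)) /\
    B = [set x | forall i, A i (tnth x i)]].

Let measurable_box n : measurable = <<s @box n >>.
Proof.
apply/seteqP; split; last first.
  apply: smallest_sub; first exact: sigma_algebra_measurable.
  move=> _ [A [mA ->]].
  rewrite (_ : [set _ | _] =
    \bigcap_(i in [set: 'I_n]) ((@tnth n T)^~ i @^-1` A i)).
    apply: fin_bigcap_measurable => // i _.
    by rewrite -[X in measurable X]setTI; apply: measurable_tnth.
  by apply/seteqP; split => [x h i _|x h i]; [exact: h|exact: (h i)].
apply: smallest_sub; first exact: smallest_sigma_algebra.
move=> B; rewrite -bigcup_seq => -[i _ [C mC <-]].
apply: sub_sigma_algebra; exists (fun j => if j == i then C else setT).
split; first by move=> j; case: ifP.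
apply/seteqP; split => [x /= [_ Cx] j|x /= /(_ i)]; first by case: eqP => [->|].
by rewrite eqxx.
Qed.

Let setI_closed_box n : setI_closed (@box n).
Proof.
move=> _ _ [A [mA ->]] [B [mB ->]]; exists (fun i => A i `&` B i); split.
  by move=> i; exact: measurableI.
by apply/seteqP; split => [x [hA hB] i|x h]; [split|split => i; case: (h i)].
Qed.

(** The product rule is only assumed for boxes.  Boxes are stable under
    intersection and generate the sigma-algebra of tuples, so, for B fixed, the
    finite measures A |-> P (sample n in A, Z n in B) and
    A |-> P (sample n in A) * P (Z n in B) are equal. *)
Lemma iid_sample_independent n : independent_mfun P (sample n) (Z n).
Proof.
move=> A B mA mB.
pose D := Z n @^-1` B.
have mD : measurable D by rewrite -[D]setTI; exact: mZ.
have PD : (0 <= fine (P D)) by exact: fine_ge0.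
pose q : {nonneg R} := NngNum PD.
have mS := @measurable_sample n.
pose m1' : {measure set (n.-tuple T) -> \bar R} :=
  pushforward (mrestr P mD) (sample n).
pose m2' : {measure set (n.-tuple T) -> \bar R} :=
  mscale q (pushforward P (sample n)).
pose m1 := m1' mS; pose m2 := m2' mS.
have PDE : (fine (P D))%:E = P D by rewrite fineK// fin_num_measure.
suff : m1 A = m2 A by rewrite /m1 /m2 /= /mscale /pushforward /mrestr /= PDE muleC.
apply: (@measure_unique _ _ _ (@box n) (fun=> setT)) => //.
- exact: measurable_box.
- exact: setI_closed_box.
- by move=> _; exists (fun=> setT); split => //; apply/seteqP; split.
- by rewrite bigcup_const.
- move=> _ [C [mC ->]].
  rewrite /m1 /m2 /= /mscale /pushforward /mrestr /= PDE.
  pose C' := fun i : 'I_n.+1 => if unlift ord_max i is Some j then C j else B.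
  have mC' i : measurable (C' i) by rewrite /C'; case: unlift.
  have C'max : C' ord_max = B by rewrite /C' unlift_none.
  have := iidZ.2 n.+1 C' mC'; rewrite big_ord_recr /= C'max => e.
  have := iidZ.2 n C mC => e2.
  transitivity (P [set w | forall i : 'I_n.+1, C' i (Z i w)]).
    congr (P _); apply/seteqP; split => [w [/= h1 h2] i|w /= h].
      rewrite /C'; case: unliftP => [j ->|->//].
      by have := h1 j; rewrite tnth_mktuple lift_max.
    split=> [i|]; last by have := h ord_max; rewrite C'max.
    have := h (lift ord_max i); rewrite /C' liftK tnth_mktuple.
    by rewrite lift_max.
  rewrite e muleC; congr (_ * _)%E.
  transitivity (P [set w | forall i : 'I_n, C i (Z i w)]).
    rewrite e2; apply: eq_bigr => i _; rewrite /C'.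
    rewrite (_ : widen_ord _ i = lift ord_max i) ?liftK//.
    by apply/val_inj; rewrite [RHS]lift_max.
  by congr (P _); apply/seteqP; split => w /= h i; have := h i; rewrite tnth_mktuple.
- move=> k; rewrite /m1/= /pushforward /mrestr/= setTI.
  by rewrite -ge0_fin_numE// fin_num_measure.
Qed.

(** This is the independence of Z j from the first j observations, applied to an
    event that only concerns the observation i. *)
Lemma iid_pairwise (A B : set T) i j : measurable A -> measurable B -> i != j ->
  P (Z i @^-1` A `&` Z j @^-1` B) = (P (Z i @^-1` A) * P (Z j @^-1` B))%E.
Proof.
move=> mA mB; wlog ij : i j A B mA mB / (i < j)%N => [H|_].
  rewrite neq_ltn => /orP[ij|ji]; first by apply: H; rewrite // neq_ltn ij.
  by rewrite setIC muleC; apply: H; rewrite // neq_ltn ji.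
have := @iid_sample_independent j (fun x => A (tnth x (Ordinal ij))) B.
have -> : sample j @^-1` (fun x => A (tnth x (Ordinal ij))) = Z i @^-1` A.
  by rewrite /preimage; apply/seteqP; split => w /=; rewrite tnth_mktuple.
apply => //.
by rewrite -[X in measurable X]setTI; apply: measurable_tnth.
Qed.

Lemma iid_ae (b : T -> bool) i : measurable_fun [set: T] b ->
  {ae P, forall w, b (Z 0%N w)} -> {ae P, forall w, b (Z i w)}.
Proof.
move=> mb [N [mN N0 QN]].
have mNb : measurable [set t | ~~ b t].
  by apply: measurable_set_of_bool; exact: measurable_neg.
have mZb k : measurable (Z k @^-1` [set t | ~~ b t]).
  by rewrite -[X in measurable X]setTI; exact: mZ.
exists (Z i @^-1` [set t | ~~ b t]); split => //; last by move=> w /= /negP.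
apply: etrans (iidZ.1 i _ mNb) _; apply: measure_negligible; first exact: mZb.
by exists N; split => // w /= /negP bw; exact: QN.
Qed.

Section frequencies.
Variable b : T -> bool.
Hypothesis mb : measurable_fun [set: T] b.

Let ind i w : R := (b (Z i w))%:R.
Let bind i : bounded_mfun (ind i).
Proof. by apply: bounded_mfun_bool; exact: measurableT_comp. Qed.

Let mB : measurable [set t | b t].
Proof. exact: measurable_set_of_bool. Qed.

Let indE i : \int[P]_w ind i w = \int[P]_w ind 0%N w.
Proof.
rewrite !Rintegral_indicator; last 2 first.
- exact: measurableT_comp.
- exact: measurableT_comp.
by congr fine; exact: (iidZ.1 i [set t | b t]).
Qed.

Let ind_pair i j : i != j ->
  \int[P]_w (ind i w * ind j w) = (\int[P]_w ind 0%N w) ^+ 2.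
Proof.
move=> ij; rewrite expr2 -{1}(indE i) -(indE j) /ind.
under eq_Rintegral do rewrite -natrM mulnb.
rewrite !Rintegral_indicator; last 3 first.
- exact: measurableT_comp.
- exact: measurableT_comp.
- by apply: measurable_and; exact: measurableT_comp.
have mZB k : measurable [set w | b (Z k w)].
  have := mZ k measurableT mB; rewrite setTI; exact.
rewrite -fineM; last 2 first.
- exact: fin_num_measure.
- exact: fin_num_measure.
rewrite -(iid_pairwise mB mB ij); congr (fine (P _)).
by apply/seteqP; split => w /= => /andP.
Qed.

(** In the square of the centred sum, the cross terms have mean zero because
    distinct observations are independent; each of the n diagonal terms is at
    most 1. *)
Lemma frequency_mean_square n : (0 < n)%N ->
  \int[P]_w (n%:R^-1 * \sum_(i < n) (b (Z i w))%:R
             - \int[P]_w' (b (Z 0%N w'))%:R) ^+ 2 <= n%:R^-1.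
Proof.
move=> n0; set p := \int[P]_w' (b (Z 0%N w'))%:R.
have n0R : n%:R != 0 :> R by rewrite pnatr_eq0 -lt0n.
pose c i w := ind i w - p.
have bc i : bounded_mfun (c i).
  by apply: bounded_mfunB => //; exact: bounded_mfun_cst.
have -> : \int[P]_w (n%:R^-1 * \sum_(i < n) (b (Z i w))%:R - p) ^+ 2 =
    \int[P]_w (n%:R^-1 ^+ 2 * \sum_(i < n) \sum_(j < n) c i w * c j w).
  apply: eq_Rintegral => w _.
  rewrite (_ : _ - p = n%:R^-1 * \sum_(i < n) c i w).
    rewrite exprMn; congr (_ * _); rewrite expr2 mulr_suml.
    by apply: eq_bigr => i _; rewrite mulr_sumr.
  rewrite /c sumrB mulrBr; congr (_ - _).
  by rewrite sumr_const card_ord -(mulr_natl p) mulrA mulVf// mul1r.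
have bcc i j : bounded_mfun (fun w => c i w * c j w) by exact: bounded_mfunM.
have bscc i : bounded_mfun (fun w => \sum_(j < n) c i w * c j w).
  exact: bounded_mfun_sum.
rewrite RintegralZl//; last by apply/bounded_mfun_integrable/bounded_mfun_sum.
rewrite Rintegral_sum//.
have -> : \sum_(i < n) \int[P]_w (\sum_(j < n) c i w * c j w) =
    \sum_(i < n) \int[P]_w (c i w * c i w).
  apply: eq_bigr => i _; rewrite Rintegral_sum// (bigD1 i)//= big1 ?addr0// => j ji.
  have -> : \int[P]_w (c i w * c j w) =
      \int[P]_w (ind i w * ind j w - p * ind i w - p * ind j w + p ^+ 2).
    by apply: eq_Rintegral => w _; rewrite /c; ring.
  have b1 : bounded_mfun (fun w => ind i w * ind j w) by exact: bounded_mfunM.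
  have b2 k : bounded_mfun (fun w => p * ind k w).
    by apply: bounded_mfunM => //; exact: bounded_mfun_cst.
  have b3 : bounded_mfun (fun w => ind i w * ind j w - p * ind i w).
    exact: bounded_mfunB.
  have b4 : bounded_mfun (fun w => ind i w * ind j w - p * ind i w - p * ind j w).
    exact: bounded_mfunB.
  rewrite RintegralD//; last 2 first.
  - exact: bounded_mfun_integrable.
  - exact/bounded_mfun_integrable/bounded_mfun_cst.
  rewrite !RintegralB//; try exact: bounded_mfun_integrable.
  rewrite !RintegralZl//; try exact: bounded_mfun_integrable; last first.
    exact/bounded_mfun_integrable/bounded_mfun_cst.
  rewrite Rintegral_probability_cst !indE ind_pair 1?eq_sym// -/p.
  by rewrite /p /ind; ring.
have p01 : 0 <= p <= 1.
  apply/andP; split; first by apply: Rintegral_ge0 => w _; exact: ler0n.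
  rewrite -[leRHS](Rintegral_probability_cst P); apply: le_Rintegral_bounded.
  - exact: (bind 0).
  - exact: bounded_mfun_cst.
  - by move=> w; case: (b _).
have ci1 i w : c i w * c i w <= 1.
  by rewrite /c /ind; case: (b _); rewrite /=; case/andP: p01 => p0 p1; nra.
have : \sum_(i < n) \int[P]_w (c i w * c i w) <= \sum_(i < n) 1.
  apply: ler_sum => i _; rewrite -[leRHS](Rintegral_probability_cst P).
  apply: le_Rintegral_bounded => //; exact: bounded_mfun_cst.
rewrite sumr_const card_ord => le_n.
apply: (le_trans (ler_wpM2l _ le_n)); first by rewrite sqr_ge0.
by rewrite expr2 -mulrA mulVf// mulr1.
Qed.

End frequencies.
End iid_samples.

(** * A uniform law of large numbers for threshold frequencies *)

Section uniform_law.
Context {dO : measure_display} {Omega : measurableType dO} {R : realType}.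
Context {dT : measure_display} {T : measurableType dT}.
Variables (P : probability Omega R) (Z : nat -> Omega -> T) (s : T -> R).
Hypotheses (mZ : forall i, measurable_fun [set: Omega] (Z i)) (iidZ : iid P Z).
Hypothesis ms : measurable_fun [set: T] s.

(** The distribution function of s (Z 0) is c-Lipschitz on the nonnegative reals.
    The bounded density of the score enters the law of large numbers in this
    form. *)
Definition lipschitz_law (c : R) := forall a b : R, 0 <= a -> a <= b ->
  \int[P]_w (a < s (Z 0%N w) <= b)%R%:R <= c * (b - a).

(** A Glivenko-Cantelli theorem in mean.  The frequency and its limit are both
    nondecreasing in lam, so within a cell of a grid they are controlled by their
    values at the two ends and by the increment of the limit over the cell, which
    the Lipschitz condition makes small.  Only finitely many thresholds remain, and
    [frequency_mean_square] treats each of them.  Bounding the deviation by a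
    measurable D spares the measurability of its supremum over lam. *)
Lemma frequency_uniform_law (c : R) (b : T -> bool) : lipschitz_law c ->
  measurable_fun [set: T] b ->
  forall e : R, 0 < e -> exists N, forall n, (N <= n)%N -> exists D : Omega -> R,
  [/\ bounded_mfun D,
      forall w lam, 0 <= lam <= 1 ->
        `|n%:R^-1 * \sum_(i < n) (b (Z i w) && (s (Z i w) <= lam)%R)%:R
          - \int[P]_w' (b (Z 0%N w') && (s (Z 0%N w') <= lam)%R)%:R| <= D w &
      \int[P]_w D w <= e].
Proof.
move=> lip mb e e0.
pose F lam := \int[P]_w' ((b (Z 0%N w') && (s (Z 0%N w') <= lam)%R)%:R : R).
pose Fn n lam w : R := n%:R^-1 * \sum_(i < n) (b (Z i w) && (s (Z i w) <= lam)%R)%:R.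
have mbl lam : measurable_fun [set: T] (fun t => b t && (s t <= lam)).
  by apply: measurable_and => //; exact: measurable_fun_ler.
have bbl lam i : bounded_mfun (fun w => (b (Z i w) && (s (Z i w) <= lam)%R)%:R : R).
  by apply: bounded_mfun_bool; exact: (measurableT_comp (mbl lam)).
have bFn n lam : bounded_mfun (Fn n lam).
  apply: bounded_mfunM; first exact: bounded_mfun_cst.
  exact: bounded_mfun_sum.
have le_F x y : x <= y -> F x <= F y.
  move=> xy; apply: le_Rintegral_bounded => // w; rewrite ler_nat.
  by case: (b _) => //=; case: (leP _ x) => //= sx; rewrite (le_trans sx).
have le_Fn n x y w : x <= y -> Fn n x w <= Fn n y w.
  move=> xy; rewrite ler_wpM2l ?invr_ge0//; apply: ler_sum => i _; rewrite ler_nat.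
  by case: (b _) => //=; case: (leP _ x) => //= sx; rewrite (le_trans sx).
have F_incr x y : 0 <= x -> x <= y -> F y - F x <= c * (y - x).
  move=> x0 xy; rewrite (le_trans _ (lip _ _ x0 xy))//.
  rewrite -RintegralB//; last 2 first.
  - exact/bounded_mfun_integrable.
  - exact/bounded_mfun_integrable.
  apply: le_Rintegral_bounded.
  - exact: bounded_mfunB.
  - apply: bounded_mfun_bool; apply: measurable_and.
      by apply: measurable_fun_ltr => //; exact: measurableT_comp.
    by apply: measurable_fun_ler => //; exact: measurableT_comp.
  - move=> w; rewrite ltNge; case: (b _) => /=; last by rewrite subrr.
    case: (leP _ x) => /= [sx|]; last by rewrite subr0.
    by rewrite (le_trans sx xy) subrr.
(* over a cell of width 1 / K the limit increases by at most e / 4 *)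
pose K := (Num.trunc (4 * `|c| / e)).+1.
have K0 : 0 < K%:R :> R by rewrite ltr0n.
have cK : `|c| / K%:R <= e / 4.
  rewrite ler_pdivrMr//.
  have : 4 * `|c| / e < K%:R by exact: truncnS_gt.
  rewrite ltr_pdivrMr// => h; nra.
pose t (j : nat) : R := j%:R / K%:R.
(* [`|v| <= d + v ^+ 2 / d] turns mean squares into means; summed over the K + 2
   grid points, the terms d amount to e / 4, and so do the terms v ^+ 2 / d as
   soon as n >= d ^- 2 *)
pose d : R := e / (4 * K.+2%:R).
have d0 : 0 < d by rewrite divr_gt0// mulr_gt0// ltr0n.
exists (Num.trunc (d^-1 ^+ 2)).+1 => n Nn.
have n0 : (0 < n)%N by exact: leq_trans Nn.
have n0R : 0 < n%:R :> R by rewrite ltr0n.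
have nd : n%:R^-1 / d <= d.
  rewrite ler_pdivrMr// -[leRHS]invrK lef_pV2 ?posrE ?invr_gt0 ?mulr_gt0//.
  rewrite invfM -expr2 (le_trans (ltW (truncnS_gt _)))//.
  by rewrite ler_nat.
pose V j w := Fn n (t j) w - F (t j).
have bV j : bounded_mfun (V j).
  by apply: bounded_mfunB => //; exact: bounded_mfun_cst.
have bV2 j : bounded_mfun (fun w => V j w ^+ 2).
  by under eq_fun do rewrite expr2; exact: bounded_mfunM.
have bdV j : bounded_mfun (fun w => d^-1 * V j w ^+ 2).
  by apply: bounded_mfunM => //; exact: bounded_mfun_cst.
have bddV j : bounded_mfun (fun w => d + d^-1 * V j w ^+ 2).
  by apply: bounded_mfunD => //; exact: bounded_mfun_cst.
exists (fun w => e / 4 + \sum_(j < K.+2) (d + d^-1 * V j w ^+ 2)); split.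
- by apply: bounded_mfunD; [exact: bounded_mfun_cst|exact: bounded_mfun_sum].
- move=> w lam /andP[lam0 lam1].
  rewrite -/(F lam) -/(Fn n lam w).
  have VD j : (j < K.+2)%N ->
      `|V j w| <= \sum_(j < K.+2) (d + d^-1 * V j w ^+ 2).
    move=> jK; rewrite (bigD1 (Ordinal jK))//= -[leLHS]addr0 lerD//; last first.
      apply: sumr_ge0 => i _; apply: addr_ge0; first exact: ltW.
      by rewrite mulr_ge0 ?sqr_ge0// invr_ge0 ltW.
    rewrite -(ler_pM2l d0) mulrDr mulVKf ?gt_eqF// -real_normK ?num_real//.
    by have := normr_ge0 (V j w); nra.
  (* the cell that contains lam; lam = 1 is why the grid has a point beyond 1 *)
  have /andP[jl lj] : (Num.trunc (lam * K%:R))%:R <= lam * K%:R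
      < (Num.trunc (lam * K%:R)).+1%:R.
    by apply: truncn_itv; rewrite mulr_ge0// ltW.
  set j := Num.trunc _ in jl lj.
  have tj : t j <= lam by rewrite /t ler_pdivrMr.
  have tj1 : lam <= t j.+1 by rewrite /t ler_pdivlMr// ltW.
  have jK : (j <= K)%N.
    rewrite -(ler_nat R) (le_trans jl)// -[leRHS]mul1r ler_wpM2r// ltW//.
  have t0 : 0 <= t j by rewrite /t divr_ge0// ltW.
  have tt : F (t j.+1) - F (t j) <= e / 4.
    rewrite (le_trans (F_incr _ _ t0 (le_trans tj tj1)))// (le_trans _ cK)//.
    rewrite /t -mulrBl -natrB// subSnn mul1r ler_wpM2r ?ler_norm//.
  have := VD j (leqW jK : (j < K.+2)%N); have := VD j.+1 (jK : (j.+1 < K.+2)%N).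
  have := le_Fn n _ _ w tj; have := le_Fn n _ _ w tj1.
  have := le_F _ _ tj; have := le_F _ _ tj1; rewrite /V.
  set S := \sum_(_ < _) _.
  by rewrite !ler_norml => h1 h2 h3 h4 /andP[h5 h6] /andP[h7 h8]; apply/andP; lra.
- rewrite RintegralD//; last 2 first.
  - exact/bounded_mfun_integrable/bounded_mfun_cst.
  - exact/bounded_mfun_integrable/bounded_mfun_sum.
  rewrite Rintegral_probability_cst Rintegral_sum//.
  have : \sum_(j < K.+2) \int[P]_w (d + d^-1 * V j w ^+ 2) <=
      \sum_(j < K.+2) (2 * d).
    apply: ler_sum => j _; rewrite RintegralD//; last 2 first.
    - exact/bounded_mfun_integrable/bounded_mfun_cst.
    - exact/bounded_mfun_integrable.
    rewrite Rintegral_probability_cst RintegralZl//; last first.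
      exact/bounded_mfun_integrable.
    have := frequency_mean_square mZ iidZ (mbl (t j)) n0.
    rewrite -/(F (t j)) => h.
    rewrite mulr2n mulrDl mul1r lerD2l (le_trans _ nd)// mulrC ler_wpM2r//.
    by rewrite ltW// invr_gt0.
  rewrite sumr_const card_ord -mulr_natl => h.
  have : K.+2%:R * (2 * d) = e / 2 by rewrite /d; field; rewrite ?nat1r ?pnatr_eq0.
  by move=> hd; lra.
Qed.

End uniform_law.

(** * The calibrated threshold of a fixed loss curve *)

Section dagger.
Context {R : realType}.
Implicit Types (L H : R -> R) (l alpha : R).

Definition within_budget n alpha L l gam :=
  n%:R / n.+1%:R * L gam + n.+1%:R^-1 - L l <= alpha.

(** A supremum is within budget exactly when all the values are; the candidates
    therefore form an interval starting at l. *)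
Lemma dagger_candidatesP n alpha L l lam : (0 < n)%N -> (forall gam, L gam <= 1) ->
  dagger_candidates n alpha L l lam <->
  l <= lam <= 1 /\ forall gam, l <= gam <= lam -> within_budget n alpha L l gam.
Proof.
move=> n0 L1.
have n0R : 0 < n%:R :> R by rewrite ltr0n.
have n1R : 0 < n.+1%:R :> R by rewrite ltr0n.
have q0 : 0 < n%:R / n.+1%:R :> R by rewrite divr_gt0.
have budgetE x : (n%:R / n.+1%:R * x + n.+1%:R^-1 - L l <= alpha) =
    (x <= (alpha + L l - n.+1%:R^-1) / (n%:R / n.+1%:R)).
  by rewrite ler_pdivlMr// mulrC lerBrDr lerBlDr.
split=> -[lamb h]; split => //; have /andP[llam lam1] := lamb.
  move=> gam gamb; rewrite /within_budget budgetE; move: h; rewrite budgetE.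
  apply: le_trans; apply: ub_le_sup; first by exists 1 => _ [g _ <-].
  by exists gam => //=; rewrite in_itv.
rewrite budgetE; apply: ge_sup.
  by exists (L l), l => //=; rewrite in_itv/= lexx.
by move=> _ [gam /= gamb <-]; rewrite -budgetE; apply: h; rewrite in_itv in gamb.
Qed.

Let budget_slope n : n%:R / n.+1%:R = 1 - n.+1%:R^-1 :> R.
Proof. by rewrite -natr1; field; rewrite natr1 pnatr_eq0. Qed.

(** A loss bounded by 1 is at most (n * L + 1) / (n + 1), so the finite sample
    correction in the budget only makes it more conservative. *)
Lemma within_budget_excess n alpha L l gam : L gam <= 1 ->
  within_budget n alpha L l gam -> L gam - L l <= alpha.
Proof.
move=> L1; apply: le_trans; rewrite budget_slope lerD2r.
have r0 : 0 <= n.+1%:R^-1 :> R by rewrite invr_ge0.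
by move: n.+1%:R^-1 r0 => r r0; nra.
Qed.

Lemma within_budget_start n alpha L l : 0 <= L l -> n.+1%:R^-1 <= alpha ->
  within_budget n alpha L l l.
Proof.
move=> L0; apply: le_trans; rewrite budget_slope.
have r0 : 0 <= n.+1%:R^-1 :> R by rewrite invr_ge0.
by move: n.+1%:R^-1 r0 => r r0; nra.
Qed.

(** A loss curve that is constant between finitely many points s i can leave the
    budget only at one of these points.  The calibrated threshold is then an
    explicit finite minimum, which is visibly measurable in the sample, unlike a
    supremum over a set that is itself defined by suprema. *)
Section step_function.
Variables (n : nat) (alpha l : R) (L : R -> R) (s : 'I_n -> R).
Hypotheses (n_gt0 : (0 < n)%N) (l_le1 : l <= 1) (L_le1 : forall gam, L gam <= 1).
Hypothesis L_step : forall gam, l <= gam ->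
  L gam = L l \/ exists i, l < s i <= gam /\ L gam = L (s i).

Let good := within_budget n alpha L l.

Definition first_overrun :=
  \big[Num.min/1]_(i < n) (if (l < s i) && ~~ good (s i) then s i else 1).

Lemma lambda_dagger_first_overrun :
  lambda_dagger n alpha L l = if good l then first_overrun else -1.
Proof.
rewrite /lambda_dagger.
have candP lam := dagger_candidatesP alpha l lam n_gt0 L_le1.
set C := dagger_candidates n alpha L l in candP *.
have [gl|ngl] := boolP (good l); last first.
  rewrite ifT//; apply/eqP; rewrite -subset0 => lam /candP[/andP[llam _]] /(_ l).
  by rewrite lexx llam => /(_ isT); apply/negP.
have Cl : C l.
  apply/candP; rewrite lexx l_le1; split => // gam.
  by rewrite -eq_le => /eqP <-.
rewrite ifF; last by apply/negP => /eqP C0; have : set0 l by rewrite -C0.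
set M := first_overrun.
have lM : l <= M.
  by apply: le_bigmin => // i _; case: ifPn => // /andP[/ltW].
have CM lam : C lam -> lam <= M.
  move=> /candP[/andP[llam lam1] h]; apply: le_bigmin => // i _.
  case: ifPn => // /andP[lsi nsi]; rewrite leNgt; apply/negP => silam.
  by move/negP: nsi; apply; apply: h; rewrite !ltW.
have MC u : l <= u -> u < M -> C u.
  move=> lu uM; apply/candP; split.
    rewrite lu (le_trans (ltW uM))//; exact: bigmin_le_id.
  move=> gam /andP[lgam gamu]; rewrite /within_budget.
  have [->//|[i [/andP[lsi sigam] ->]]] := L_step lgam.
  apply/negPn/negP => nsi.
  have : M <= s i.
    rewrite (le_trans (bigmin_le _ i _))// lsi /=.
    by rewrite /good /within_budget nsi.
  by rewrite leNgt (le_lt_trans sigam)// (le_lt_trans gamu).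
have hC : has_ubound C by exists M => lam /CM.
apply/eqP; rewrite eq_le; apply/andP; split.
  by apply: ge_sup; [exists l|move=> lam /CM].
rewrite leNgt; apply/negP => supM.
have lsup : l <= sup C by exact: ub_le_sup.
have Cu : C ((sup C + M) / 2).
  by apply: MC; [rewrite (le_trans lsup)//|]; lra.
have := ub_le_sup hC Cu; lra.
Qed.

End step_function.

(** The supremum of the candidates need not be a candidate, hence the points that
    approach it from below. *)
Lemma lambda_dagger_near n alpha L l : (0 < n)%N -> l <= 1 ->
  (forall gam, 0 <= L gam <= 1) -> n.+1%:R^-1 <= alpha ->
  l <= lambda_dagger n alpha L l <= 1 /\
  forall e, 0 < e -> exists lam,
    [/\ l <= lam, lambda_dagger n alpha L l - e < lam <= lambda_dagger n alpha L l &
        L lam - L l <= alpha].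
Proof.
move=> n0 l1 L01 nalpha.
have L1 gam : L gam <= 1 by have /andP[] := L01 gam.
have candP lam := dagger_candidatesP alpha l lam n0 L1.
rewrite /lambda_dagger.
set C := dagger_candidates n alpha L l in candP *.
have Cl : C l.
  apply/candP; rewrite lexx l1; split => // gam.
  rewrite -eq_le => /eqP <-; apply: within_budget_start => //.
  by have /andP[] := L01 l.
rewrite ifF; last by apply/negP => /eqP C0; have : set0 l by rewrite -C0.
have hC : has_ubound C by exists 1 => lam /candP[/andP[]].
have supC : has_sup C by split => //; exists l.
split.
  rewrite (ub_le_sup hC Cl)/=; apply: ge_sup; first by exists l.
  by move=> lam /candP[/andP[]].
move=> e e0; have [lam Clam elam] := sup_adherent e0 supC.
have /candP[/andP[llam _] h] := Clam.
exists lam; split => //; first by rewrite elam (ub_le_sup hC Clam).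
by apply: (within_budget_excess (L1 _)); apply: h; rewrite llam lexx.
Qed.

(** The deterministic core of the theorem.  Here k + H is the mean loss curve, which
    the empirical curve L approximates up to D, and which decreases until cp.
    Replacing a difference H lam - H cp by L lam - L cp costs 2 * D.
    - If the threshold lies below cp then, being at least l, it has a mean loss at
      most that of l, and L l <= L cp since l minimizes L.
    - At a candidate lam, L lam exceeds L l, and hence L cp, by at most alpha; the
      Lipschitz condition extends this bound to the supremum of the candidates. *)
Lemma lambda_dagger_excess n alpha L l H (k c cp D : R) :
  (0 < n)%N -> (forall gam, 0 <= L gam <= 1) -> n.+1%:R^-1 <= alpha ->
  minimizes01 L l -> 0 <= cp <= 1 ->
  (forall lam, 0 <= lam <= 1 -> `|L lam - (k + H lam)| <= D) ->
  (forall a b, 0 <= a -> a <= b -> `|H b - H a| <= c * (b - a)) ->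
  (forall a b, a <= b -> b <= cp -> H b <= H a) ->
  H (Num.min cp (lambda_dagger n alpha L l)) - H cp <= 2 * D /\
  H (lambda_dagger n alpha L l) - H cp <= alpha + 2 * D.
Proof.
move=> n0 L01 nalpha [/andP[l0 l1] lmin] /andP[cp0 cp1] LH lipH monH.
have [] := lambda_dagger_near n0 l1 L01 nalpha.
set ld := lambda_dagger n alpha L l => /andP[lld ld1] near_ld.
have D0 : 0 <= D by rewrite (le_trans (normr_ge0 _) (LH 0 _))// lexx ler01.
have lcp : L l <= L cp by apply: lmin; rewrite cp0.
have Hcp lam : 0 <= lam <= 1 -> H lam - H cp <= L lam - L l + 2 * D.
  move=> lam01; have := LH _ lam01; have : 0 <= cp <= 1 by rewrite cp0.
  move=> /LH; rewrite !ler_norml => /andP[h1 h2] /andP[h3 h4]; lra.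
split.
  have [cpld|ldcp] := leP cp ld; first by rewrite subrr mulr_ge0.
  have := Hcp l; rewrite l0 l1 subrr add0r => /(_ isT); apply: le_trans.
  by rewrite lerD2r; apply: monH => //; exact: ltW.
have c0 : 0 <= c.
  have := lipH 0 1 (lexx _) ler01; rewrite subr0 mulr1; apply: le_trans.
  exact: normr_ge0.
apply/ler_addgt0Pr => e e0.
have e10 : 0 < e / (c + 1) by rewrite divr_gt0// ltr_wpDl.
have [lam [llam /andP[ldlam lamld] Llam]] := near_ld _ e10.
have lam0 : 0 <= lam := le_trans l0 llam.
have lam01 : 0 <= lam <= 1 by rewrite lam0 (le_trans lamld).
have := Hcp _ lam01; have := lipH _ _ lam0 lamld.
have : c * (ld - lam) <= e.
  have : ld - lam <= e / (c + 1) by lra.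
  rewrite ler_pdivlMr; last lra.
  nra.
rewrite ler_norml => h1 /andP[_ h2] h3; lra.
Qed.

End dagger.

(** * The loss as a function of the threshold and of the sample *)

Lemma measurable_fun_sumr {d0} {T0 : measurableType d0} {R : realType} (I : Type)
    (r : seq I) (F : I -> T0 -> R) :
  (forall i, measurable_fun [set: T0] (F i)) ->
  measurable_fun [set: T0] (fun x => \sum_(i <- r) F i x).
Proof.
move=> mF; elim: r => [|i r IH].
  by under eq_fun do rewrite big_nil; exact: measurable_cst.
by under eq_fun do rewrite big_cons; exact: measurable_funD.
Qed.

Lemma measurable_fun_bigminr {d0} {T0 : measurableType d0} {R : realType} (I : Type)
    (r : seq I) (c : R) (F : I -> T0 -> R) :
  (forall i, measurable_fun [set: T0] (F i)) ->
  measurable_fun [set: T0] (fun x => \big[Num.min/c]_(i <- r) F i x).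
Proof.
move=> mF; elim: r => [|i r IH].
  by under eq_fun do rewrite big_nil; exact: measurable_cst.
by under eq_fun do rewrite big_cons; exact: measurable_minr.
Qed.

Section threshold_loss.
Context {R : realType} {d : nat}.
Variables (pR : R) (pi : d.-tuple R -> R).
Let T := (d.-tuple R * bool)%type.

(** The part of the loss that depends on the threshold: declaring x reliable
    replaces the cost 1 - pR by 1 - y. *)
Definition gain lam (t : T) : R :=
  (pR - t.2%:R) * (score pi t.1 <= lam)%R%:R.

Lemma loss_gain lam (t : T) : loss pR pi lam t.1 t.2 = (1 - pR) + gain lam t.
Proof.
rewrite /loss /gain /score.
have -> : (1 - pi t.1 <= lam) = (1 - lam <= pi t.1).
  by rewrite lerBlDr addrC -lerBlDr.
by rewrite ltNge; case: (1 - lam <= _); case: t.2 => /=; ring.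
Qed.

Lemma type1_integrandE eta lam x (y : bool) : unit_cube x ->
  type1_integrand eta pi pR lam x y =
  (pR - y%:R) * ((score pi x <= lam) && (eta x < pR))%:R.
Proof.
move=> cx; rewrite /type1_integrand indicE; congr (_ * _%:R); congr nat_of_bool.
apply/idP/andP => [|[slam etap]].
  rewrite inE => -[[_ pilam] nrel]; split.
    by rewrite /score lerBlDr addrC -lerBlDr.
  by rewrite ltNge; apply/negP => peta; exact: nrel.
rewrite inE; split; first by split => //; rewrite lerBlDr addrC -lerBlDr.
by move=> [_]; rewrite leNgt etap.
Qed.

(** If eta falls below pR exactly where the score exceeds cp, then the points wrongly
    declared reliable are those with score in ]cp, lam]. *)
Lemma type1_integrand_gain eta cp lam (t : T) : unit_cube t.1 ->
  (eta t.1 < pR) = (cp < score pi t.1) ->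
  type1_integrand eta pi pR lam t.1 t.2 = gain lam t - gain (Num.min cp lam) t.
Proof.
move=> ct sgn; rewrite type1_integrandE// sgn /gain -mulrBr; congr (_ * _).
rewrite le_min ltNge; case: (_ <= cp) => /=; first by rewrite andbF subrr.
by rewrite andbT subr0.
Qed.

Lemma empirical_loss_gain n (z : n.-tuple T) lam : (0 < n)%N ->
  empirical_loss pR pi z lam =
  (1 - pR) + n%:R^-1 * \sum_(i < n) gain lam (tnth z i).
Proof.
move=> n0; rewrite /empirical_loss; under eq_bigr do rewrite loss_gain.
rewrite big_split/= sumr_const card_ord mulrDr -(mulr_natl (1 - pR)) mulKf//.
by rewrite pnatr_eq0 -lt0n.
Qed.

Hypothesis pR01 : 0 < pR < 1.

Lemma empirical_loss01 n (z : n.-tuple T) lam : 0 <= empirical_loss pR pi z lam <= 1.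
Proof.
have [p0 p1] := andP pR01.
have loss01 (t : T) : 0 <= loss pR pi lam t.1 t.2 <= 1.
  by rewrite loss_gain /gain; case: t.2; case: (_ <= lam) => /=; apply/andP; lra.
apply/andP; split.
  rewrite mulr_ge0 ?invr_ge0//; apply: sumr_ge0 => i _.
  by have /andP[] := loss01 (tnth z i).
case: n z => [|n] z; first by rewrite /empirical_loss big_ord0 mulr0 ler01.
rewrite /empirical_loss mulrC ler_pdivrMr ?ltr0n// mul1r.
have : \sum_(i < n.+1) loss pR pi lam (tnth z i).1 (tnth z i).2 <= \sum_(i < n.+1) 1.
  by apply: ler_sum => i _; have /andP[] := loss01 (tnth z i).
by rewrite sumr_const card_ord.
Qed.

(** The witness is the largest observed score in ]l, gam]. *)
Lemma empirical_loss_step n (z : n.-tuple T) l gam : l <= gam ->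
  empirical_loss pR pi z gam = empirical_loss pR pi z l \/
  exists i, l < score pi (tnth z i).1 <= gam /\
    empirical_loss pR pi z gam = empirical_loss pR pi z (score pi (tnth z i).1).
Proof.
move=> lgam; pose s i := score pi (tnth z i).1.
have same u : u <= gam -> (forall i, s i <= gam -> s i <= u) ->
    empirical_loss pR pi z gam = empirical_loss pR pi z u.
  move=> ugam su; rewrite /empirical_loss; congr (_ * _); apply: eq_bigr => i _.
  rewrite !loss_gain /gain; congr (_ + _ * _%:R); congr nat_of_bool.
  by apply/idP/idP => [/su//|siu]; exact: le_trans ugam.
have [[i0 i0P]|none] := pselect (exists i, l < s i <= gam); last first.
  left; apply: same => // i sig; rewrite leNgt; apply/negP => lsi.
  by apply: none; exists i; rewrite lsi.
right; case: (@Order.TotalTheory.arg_maxP _ _ _ i0 (fun i => l < s i <= gam) s i0P).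
move=> i iP imax; exists i; split => //.
have /andP[lsi sig] := iP.
apply: same => // j sjg; have [lsj|sjl] := ltP l (s j).
  by apply: imax; rewrite lsj.
by rewrite (le_trans sjl)// ltW.
Qed.

Hypothesis mpi : measurable_fun [set: d.-tuple R] pi.

Lemma measurable_score : measurable_fun [set: d.-tuple R] (score pi).
Proof. by apply: measurable_funB => //; exact: measurable_cst. Qed.

Lemma gain_bounded : bounded_mfun (fun p : R * T => gain p.1 p.2).
Proof.
rewrite /gain; apply: bounded_mfunM.
  apply: bounded_mfunB; first exact: bounded_mfun_cst.
  by apply: bounded_mfun_bool; exact: measurableT_comp.
apply: bounded_mfun_bool; apply: measurable_fun_ler => //.
apply: (measurableT_comp measurable_score).
exact: measurableT_comp.
Qed.

Lemma measurable_empirical_loss n (gam : n.-tuple T -> R) :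
  measurable_fun [set: n.-tuple T] gam ->
  measurable_fun [set: n.-tuple T] (fun z => empirical_loss pR pi z (gam z)).
Proof.
move=> mgam; apply: measurable_funM; first exact: measurable_cst.
apply: measurable_fun_sumr => i.
under eq_fun do rewrite loss_gain.
apply: measurable_funD; first exact: measurable_cst.
apply: (measurableT_comp gain_bounded.1 (g := fun z => (gam z, tnth z i))).
by apply: measurable_fun_pair => //; exact: measurable_tnth.
Qed.

Lemma measurable_lambda_dagger n alpha (l : n.-tuple T -> R) : (0 < n)%N ->
  measurable_fun [set: n.-tuple T] l -> (forall z, l z <= 1) ->
  measurable_fun [set: n.-tuple T]
    (fun z => lambda_dagger n alpha (empirical_loss pR pi z) (l z)).
Proof.
move=> n0 ml l1.
pose s i (z : n.-tuple T) := score pi (tnth z i).1.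
have ms i : measurable_fun [set: n.-tuple T] (s i).
  apply: (measurableT_comp measurable_score).
  by apply: (measurableT_comp measurable_fst); exact: measurable_tnth.
have mgood gam : measurable_fun [set: n.-tuple T] gam ->
    measurable_fun [set: n.-tuple T] (fun z =>
      within_budget n alpha (empirical_loss pR pi z) (l z) (gam z)).
  move=> mgam; apply: measurable_fun_ler; last exact: measurable_cst.
  apply: measurable_funB; last exact: measurable_empirical_loss.
  apply: measurable_funD; last exact: measurable_cst.
  by apply: measurable_funM; [exact: measurable_cst|exact: measurable_empirical_loss].
rewrite (_ : (fun z => _) = fun z =>
  if within_budget n alpha (empirical_loss pR pi z) (l z) (l z)
  then first_overrun alpha (l z) (empirical_loss pR pi z) (s ^~ z) else -1).
  apply: measurable_fun_ifT => //; first exact: mgood.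
  apply: measurable_fun_bigminr => i; apply: measurable_fun_ifT => //.
  apply: measurable_and; first exact: measurable_fun_ltr.
  by apply: measurable_neg; exact: mgood.
apply/funext => z; apply: lambda_dagger_first_overrun => //.
- by move=> gam; have /andP[] := empirical_loss01 z gam.
- by move=> gam; exact: empirical_loss_step.
Qed.

End threshold_loss.

(** * The threshold computed from an independent sample *)

Section calibration.
Context {dO : measure_display} {Omega : measurableType dO} {R : realType} {d : nat}.
Let T := (d.-tuple R * bool)%type.
Variables (P : probability Omega R) (Z : nat -> Omega -> T).
Hypotheses (mZ : forall i, measurable_fun [set: Omega] (Z i)) (iidZ : iid P Z).
Variables (pR : R) (pi : d.-tuple R -> R).
Hypotheses (pR01 : 0 < pR < 1) (mpi : measurable_fun [set: d.-tuple R] pi).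
Variable c : R.
Hypothesis lip : lipschitz_law P Z (fun t => score pi t.1) c.

Definition mean_gain lam := \int[P]_w gain pR pi lam (Z 0%N w).

Lemma gain_sample_bounded (lam : Omega -> R) i : measurable_fun [set: Omega] lam ->
  bounded_mfun (fun w => gain pR pi (lam w) (Z i w)).
Proof.
move=> mlam; have [mg [M gM]] := gain_bounded pR mpi.
split; last by exists M => w; exact: (gM (lam w, Z i w)).
by apply: (measurableT_comp mg (g := fun w => (lam w, Z i w))); exact: measurable_fun_pair.
Qed.

(** Both terms of the gain have means that are probabilities of events on one
    observation, and these do not depend on its index. *)
Lemma mean_gain_sample lam i :
  \int[P]_w gain pR pi lam (Z i w) = mean_gain lam.
Proof.
have ms := measurable_score mpi.
have msZ k : measurable_fun [set: Omega] (fun w => score pi (Z k w).1 <= lam).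
  apply: measurable_fun_ler => //; apply: (measurableT_comp ms).
  exact: measurableT_comp.
have my k : measurable_fun [set: Omega] (fun w => (Z k w).2).
  exact: measurableT_comp.
have split_gain k : \int[P]_w gain pR pi lam (Z k w) =
    pR * fine (P [set w | score pi (Z k w).1 <= lam])
    - fine (P [set w | (Z k w).2 && (score pi (Z k w).1 <= lam)]).
  have b1 : bounded_mfun (fun w => (score pi (Z k w).1 <= lam)%R%:R : R).
    exact: bounded_mfun_bool.
  have b2 : bounded_mfun (fun w => ((Z k w).2 && (score pi (Z k w).1 <= lam)%R)%:R : R).
    by apply: bounded_mfun_bool; exact: measurable_and.
  rewrite -!Rintegral_indicator//; last exact: measurable_and.
  rewrite -RintegralZl//; last exact: bounded_mfun_integrable.
  rewrite -RintegralB//; last 2 first.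
  - apply: bounded_mfun_integrable.
    by apply: bounded_mfunM => //; exact: bounded_mfun_cst.
  - exact: bounded_mfun_integrable.
  apply: eq_Rintegral => w _; rewrite /gain.
  by case: (Z k w).2; case: (_ <= lam) => /=; ring.
rewrite /mean_gain !split_gain.
pose A := [set t : T | score pi t.1 <= lam].
pose B := [set t : T | t.2 && (score pi t.1 <= lam)].
have msT : measurable_fun [set: T] (fun t => score pi t.1 <= lam).
  apply: measurable_fun_ler => //; apply: (measurableT_comp ms).
  exact: measurable_fst.
have mA : measurable A by exact: measurable_set_of_bool.
have mB : measurable B.
  by apply: measurable_set_of_bool; apply: measurable_and => //; exact: measurable_snd.
by congr (_ * fine _ - fine _); [exact: (iidZ.1 i A)|exact: (iidZ.1 i B)].
Qed.

Lemma mean_gain_increment lam1 lam2 : lam1 <= lam2 ->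
  mean_gain lam2 - mean_gain lam1 =
  \int[P]_w ((pR - (Z 0%N w).2%:R) * (lam1 < score pi (Z 0%N w).1 <= lam2)%R%:R).
Proof.
move=> l12; rewrite /mean_gain -RintegralB//; last 2 first.
- exact/bounded_mfun_integrable/(gain_sample_bounded _ (measurable_cst _)).
- exact/bounded_mfun_integrable/(gain_sample_bounded _ (measurable_cst _)).
apply: eq_Rintegral => w _; rewrite /gain -mulrBr; congr (_ * _).
rewrite ltNge; case: (leP _ lam1) => [slam|_] /=; last by rewrite subr0.
by rewrite (le_trans slam l12) subrr.
Qed.

Lemma mean_gain_lipschitz lam1 lam2 : 0 <= lam1 -> lam1 <= lam2 ->
  `|mean_gain lam2 - mean_gain lam1| <= c * (lam2 - lam1).
Proof.
move=> l0 l12; rewrite mean_gain_increment// (le_trans _ (lip l0 l12))//.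
have ms : measurable_fun [set: Omega] (fun w => score pi (Z 0%N w).1).
  by apply: (measurableT_comp (measurable_score mpi)); exact: measurableT_comp.
have b1 : bounded_mfun (fun w => (lam1 < score pi (Z 0%N w).1 <= lam2)%R%:R : R).
  apply: bounded_mfun_bool; apply: measurable_and.
    exact: measurable_fun_ltr.
  exact: measurable_fun_ler.
have b2 : bounded_mfun (fun w => pR - (Z 0%N w).2%:R : R).
  apply: bounded_mfunB; first exact: bounded_mfun_cst.
  by apply: bounded_mfun_bool; exact: measurableT_comp.
have b3 := bounded_mfunM b2 b1.
apply: (le_trans (le_normr_Rintegral measurableT (bounded_mfun_integrable P b3))).
apply: le_Rintegral_bounded => //; first exact: bounded_mfun_norm.
move=> w; have [p0 p1] := andP pR01.
by case: (Z 0%N w).2; case: (_ && _) => /=; rewrite ler_norml; apply/andP; lra.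
Qed.

(** The mean gain over the sample is pR times the frequency of scores below lam, minus
    the frequency of successes among them; [frequency_uniform_law] applies to
    both. *)
Lemma empirical_loss_uniform_law e : 0 < e -> exists N, forall n, (N <= n)%N ->
  exists D : Omega -> R,
  [/\ bounded_mfun D,
      forall w lam, 0 <= lam <= 1 ->
        `|empirical_loss pR pi (sample Z n w) lam - ((1 - pR) + mean_gain lam)| <= D w &
      \int[P]_w D w <= e].
Proof.
move=> e0; have e20 : 0 < e / 2 by rewrite divr_gt0.
have ms : measurable_fun [set: T] (fun t => score pi t.1).
  by apply: (measurableT_comp (measurable_score mpi)); exact: measurable_fst.
have [N1 law1] := frequency_uniform_law mZ iidZ ms lip
  (measurable_cst true : measurable_fun [set: T] _) e20.
have [N2 law2] := frequency_uniform_law mZ iidZ ms lip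
  (measurable_snd : measurable_fun [set: T] _) e20.
exists (maxn 1 (maxn N1 N2)) => n; rewrite !geq_max => /and3P[n0 nN1 nN2].
have [D1 [bD1 D1P D1e]] := law1 n nN1.
have [D2 [bD2 D2P D2e]] := law2 n nN2.
exists (fun w => D1 w + D2 w); split.
- exact: bounded_mfunD.
- move=> w lam lam01; have := D1P w lam lam01; have := D2P w lam lam01.
  have msZ k : measurable_fun [set: Omega] (fun w => score pi (Z k w).1 <= lam).
    apply: measurable_fun_ler => //; apply: (measurableT_comp ms); exact: mZ.
  set F2n := n%:R^-1 * _; set F2 := \int[P]_w' _.
  set F1n := n%:R^-1 * _; set F1 := \int[P]_w' _.
  move=> h2 h1.
  have -> : mean_gain lam = pR * F1 - F2.
    rewrite /F1 /F2 -RintegralZl//; last first.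
      by apply/bounded_mfun_integrable/bounded_mfun_bool; exact: msZ.
    rewrite -RintegralB//; last 2 first.
    - apply/bounded_mfun_integrable/bounded_mfunM; first exact: bounded_mfun_cst.
      by apply/bounded_mfun_bool; exact: msZ.
    - apply/bounded_mfun_integrable/bounded_mfun_bool/measurable_and => //.
      exact: measurableT_comp.
    apply: eq_Rintegral => w' _; rewrite /gain.
    by case: (Z 0%N w').2; case: (_ <= lam) => /=; ring.
  have -> : empirical_loss pR pi (sample Z n w) lam = (1 - pR) + (pR * F1n - F2n).
    rewrite empirical_loss_gain//; congr (_ + _).
    rewrite /F1n /F2n mulrCA -mulrBr; congr (_ * _).
    rewrite mulr_sumr -sumrB; apply: eq_bigr => i _; rewrite tnth_mktuple /gain.
    by case: (Z i w).2; case: (_ <= lam) => /=; ring.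
  have -> : 1 - pR + (pR * F1n - F2n) - (1 - pR + (pR * F1 - F2)) =
    pR * (F1n - F1) - (F2n - F2) by ring.
  rewrite (le_trans (ler_normB _ _))// lerD//.
  rewrite (le_trans _ h1)// normrM ler_piMl//.
  by have [p0 p1] := andP pR01; rewrite gtr0_norm// ltW.
- rewrite RintegralD//; try exact: bounded_mfun_integrable.
  lra.
Qed.

Lemma mean_empirical_loss n lam : (0 < n)%N ->
  ('E_P[fun w => empirical_loss pR pi (sample Z n w) lam] =
   ((1 - pR) + mean_gain lam)%R%:E)%E.
Proof.
move=> n0; rewrite (_ : (fun w => _) = fun w =>
  (1 - pR) + n%:R^-1 * \sum_(i < n) gain pR pi lam (Z i w)); last first.
  apply/funext => w; rewrite empirical_loss_gain//; congr (_ + _ * _).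
  by apply: eq_bigr => i _; rewrite tnth_mktuple.
have bg i : bounded_mfun (fun w => gain pR pi lam (Z i w)).
  exact: (gain_sample_bounded i (measurable_cst lam)).
have bsum : bounded_mfun (fun w => \sum_(i < n) gain pR pi lam (Z i w)).
  exact: bounded_mfun_sum.
have bavg : bounded_mfun (fun w => n%:R^-1 * \sum_(i < n) gain pR pi lam (Z i w)).
  by apply: bounded_mfunM => //; exact: bounded_mfun_cst.
have bp : bounded_mfun (fun _ : Omega => 1 - pR) by exact: bounded_mfun_cst.
rewrite expectation_Rintegral/=; last exact: bounded_mfunD.
rewrite RintegralD//; try exact: bounded_mfun_integrable.
rewrite RintegralZl//; last exact: bounded_mfun_integrable.
rewrite Rintegral_probability_cst Rintegral_sum//; congr ((_ + _)%:E).
under eq_bigr do rewrite mean_gain_sample.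
by rewrite sumr_const card_ord -(mulr_natl (mean_gain _)) mulKf// pnatr_eq0 -lt0n.
Qed.

(** The increment of the mean gain over ]a, b] is the mean of pR - V over the event
    that the score lies in ]a, b], and pR - V has the sign of the score minus cp. *)
Lemma mean_gain_crossing (V : Omega -> R) cp : bounded_mfun V ->
  (forall a b, let J w := (a < score pi (Z 0%N w).1 <= b)%R%:R in
    \int[P]_w ((Z 0%N w).2%:R * J w) = \int[P]_w (V w * J w)) ->
  {ae P, forall w, 0 < (pR - V w) * (score pi (Z 0%N w).1 - cp)} ->
  (forall lam1 lam2, lam1 <= lam2 -> lam2 <= cp ->
    mean_gain lam2 <= mean_gain lam1) /\
  (forall lam1 lam2, cp <= lam1 -> lam1 <= lam2 ->
    mean_gain lam1 <= mean_gain lam2).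
Proof.
move=> bV condV sign.
pose J a b w : R := (a < score pi (Z 0%N w).1 <= b)%R%:R.
have mS : measurable_fun [set: Omega] (fun w => score pi (Z 0%N w).1).
  by apply: (measurableT_comp (measurable_score mpi)); exact: measurableT_comp.
have bJ a b : bounded_mfun (J a b).
  apply: bounded_mfun_bool; apply: measurable_and.
    exact: measurable_fun_ltr.
  exact: measurable_fun_ler.
have bY : bounded_mfun (fun w => (Z 0%N w).2%:R : R).
  by apply: bounded_mfun_bool; exact: measurableT_comp.
have bpJ a b : bounded_mfun (fun w => pR * J a b w).
  by apply: bounded_mfunM => //; exact: bounded_mfun_cst.
have bVJ a b : bounded_mfun (fun w => (pR - V w) * J a b w).
  by apply: bounded_mfunM => //; apply: bounded_mfunB => //; exact: bounded_mfun_cst.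
have incr a b : a <= b ->
    mean_gain b - mean_gain a = \int[P]_w ((pR - V w) * J a b w).
  move=> ab; rewrite mean_gain_increment//.
  transitivity (\int[P]_w (pR * J a b w - (Z 0%N w).2%:R * J a b w)).
    by apply: eq_Rintegral => w _; rewrite mulrBl.
  transitivity (\int[P]_w (pR * J a b w - V w * J a b w)); last first.
    by apply: eq_Rintegral => w _; rewrite mulrBl.
  rewrite !RintegralB//; try exact: bounded_mfun_integrable.
  - by rewrite condV.
  - exact/bounded_mfun_integrable/bounded_mfunM.
  - exact/bounded_mfun_integrable/bounded_mfunM.
split=> a b.
- move=> ab bcp; rewrite -subr_ge0 -opprB incr// -mulN1r -RintegralZl//; last first.
    exact: bounded_mfun_integrable.
  apply: Rintegral_ae_ge0.
    by apply: bounded_mfunM => //; exact: bounded_mfun_cst.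
  apply: ae_imply sign => w sw; rewrite /J; have [/andP[aS Sb]|] := boolP (_ && _).
    by rewrite mulr1; nra.
  by rewrite !mulr0.
- move=> cpa ab; rewrite -subr_ge0 incr//; apply: Rintegral_ae_ge0 => //.
  apply: ae_imply sign => w sw; rewrite /J; have [/andP[aS _]|] := boolP (_ && _).
    by rewrite mulr1; nra.
  by rewrite mulr0.
Qed.

Variables (alpha cp : R) (lamstar : forall n : nat, n.-tuple T -> R).
Hypotheses (alpha_gt0 : 0 < alpha) (cp01 : 0 <= cp <= 1).
Hypothesis mlamstar : forall n, measurable_fun [set: n.-tuple T] (@lamstar n).
Hypothesis lamstar_le1 : forall n (z : n.-tuple T), lamstar z <= 1.
Hypothesis lamstar_min : forall n w,
  minimizes01 (empirical_loss pR pi (sample Z n w)) (lamstar (sample Z n w)).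
Hypothesis mean_gain_decr : forall lam1 lam2, lam1 <= lam2 -> lam2 <= cp ->
  mean_gain lam2 <= mean_gain lam1.
Hypothesis mean_gain_incr : forall lam1 lam2, cp <= lam1 -> lam1 <= lam2 ->
  mean_gain lam1 <= mean_gain lam2.

Definition dagger n w := lambda_dagger n alpha
  (empirical_loss pR pi (sample Z n w)) (lamstar (sample Z n w)).

Lemma mean_gain_min lam : mean_gain cp <= mean_gain lam.
Proof.
have [cplam|/ltW lamcp] := leP cp lam; first exact: mean_gain_incr.
exact: mean_gain_decr.
Qed.

(** A threshold computed from the first n observations is independent of the next
    one, so that the latter may be integrated first. *)
Lemma gain_independent_threshold n (lam : n.-tuple T -> R) :
  measurable_fun [set: n.-tuple T] lam ->
  bounded_mfun (fun w => mean_gain (lam (sample Z n w))) /\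
  \int[P]_w gain pR pi (lam (sample Z n w)) (Z n w) =
  \int[P]_w mean_gain (lam (sample Z n w)).
Proof.
move=> mlam; have mS := measurable_sample mZ (n := n).
have bphi : bounded_mfun (fun p : n.-tuple T * T => gain pR pi (lam p.1) p.2).
  have [mg [M gM]] := gain_bounded pR mpi.
  split; last by exists M => p; exact: (gM (lam p.1, p.2)).
  apply: (measurableT_comp mg (g := fun p => (lam p.1, p.2))).
  by apply: measurable_fun_pair => //; exact: measurableT_comp.
have [[mI [M IM]] ->] := independent_expectation mS (mZ n)
  (iid_sample_independent mZ iidZ (n := n)) bphi.
have IE (w : Omega) : \int[P]_w' gain pR pi (lam (sample Z n w)) (Z n w') =
    mean_gain (lam (sample Z n w)) by exact: mean_gain_sample.
split; last by apply: eq_Rintegral => w _; rewrite IE.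
split; last by exists M => w; rewrite -IE; exact: IM.
under eq_fun do rewrite -IE; exact: (measurableT_comp mI).
Qed.

Lemma measurable_dagger n : (0 < n)%N -> measurable_fun [set: Omega] (dagger n).
Proof.
move=> n0.
exact: (measurableT_comp (measurable_lambda_dagger pR01 mpi alpha n0
  (@mlamstar n) (@lamstar_le1 n)) (measurable_sample mZ (n := n))).
Qed.

(** The threshold Num.min cp (dagger n w) isolates the loss incurred by stopping
    below cp; this loss vanishes in the limit, whereas the excess of the
    threshold itself may approach alpha. *)
Lemma dagger_gain_asymptotics e : 0 < e -> exists N, forall n, (N <= n)%N ->
  [/\ \int[P]_w gain pR pi (dagger n w) (Z n w) - mean_gain cp <= alpha + e,
      0 <= \int[P]_w gain pR pi (Num.min cp (dagger n w)) (Z n w) - mean_gain cp &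
      \int[P]_w gain pR pi (Num.min cp (dagger n w)) (Z n w) - mean_gain cp <= e].
Proof.
move=> e0; have e20 : 0 < e / 2 by rewrite divr_gt0.
have [N lawN] := empirical_loss_uniform_law e20.
exists (maxn N (Num.trunc alpha^-1).+1) => n; rewrite geq_max => /andP[nN nalpha].
have n0 : (0 < n)%N by exact: leq_trans nalpha.
(* the budget then contains its starting point, and the threshold is not -1 *)
have n1alpha : n.+1%:R^-1 <= alpha.
  rewrite -[leRHS]invrK lef_pV2 ?posrE ?invr_gt0// ?ltr0n//.
  rewrite (le_trans (ltW (truncnS_gt _)))// ler_nat.
  exact: (leq_trans nalpha).
have [D [bD DP De]] := lawN n nN.
have mld := measurable_lambda_dagger pR01 mpi alpha n0 (@mlamstar n) (@lamstar_le1 n).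
have mmin := measurable_minr (measurable_cst cp) mld.
have [b1 E1] := gain_independent_threshold mld.
have [b2 E2] := gain_independent_threshold mmin.
have bound w := lambda_dagger_excess n0
  (empirical_loss01 pi pR01 (sample Z n w)) n1alpha (lamstar_min n w) cp01
  (DP w) mean_gain_lipschitz mean_gain_decr.
have b2D : bounded_mfun (fun w => 2 * D w).
  by apply: bounded_mfunM => //; exact: bounded_mfun_cst.
have I2D : \int[P]_w (2 * D w) <= e.
  by rewrite RintegralZl//; [lra|exact: bounded_mfun_integrable].
have bc (k : R) := @bounded_mfun_cst _ Omega R k.
rewrite /dagger E1 E2.
have IB (f : Omega -> R) : bounded_mfun f ->
    \int[P]_w f w - mean_gain cp = \int[P]_w (f w - mean_gain cp).
  move=> bf; rewrite RintegralB//; last 2 first.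
  - exact: bounded_mfun_integrable.
  - exact: bounded_mfun_integrable.
  by rewrite Rintegral_probability_cst.
rewrite !IB//; split.
- apply: (@le_trans _ _ (\int[P]_w (alpha + 2 * D w))).
    apply: le_Rintegral_bounded; [exact: bounded_mfunB|exact: bounded_mfunD|].
    by move=> w; have [] := bound w.
  rewrite RintegralD//; last 2 first.
  - exact: bounded_mfun_integrable.
  - exact: bounded_mfun_integrable.
  by rewrite Rintegral_probability_cst lerD2l.
- by apply: Rintegral_ge0 => w _; rewrite subr_ge0 mean_gain_min.
- apply: le_trans I2D; apply: le_Rintegral_bounded => //.
    exact: bounded_mfunB.
  by move=> w; have [] := bound w.
Qed.

End calibration.

(** * The law of the score and the success probability given the score *)

Section random_score.
Context {dO : measure_display} {Omega : measurableType dO} {R : realType}.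
Variable P : probability Omega R.

(** Applied with mu the law of an observation, the law of the score, or Lebesgue
    measure, whose null sets are also null for the law of the score. *)
Lemma ae_comp {dU} {U : measurableType dU} (mu : {measure set U -> \bar R})
    (W : Omega -> U) (Q : U -> Prop) : measurable_fun [set: Omega] W ->
  (forall A, measurable A -> mu A = 0%E -> P (W @^-1` A) = 0%E) ->
  {ae mu, forall u, Q u} -> {ae P, forall w, Q (W w)}.
Proof.
move=> mW null [N [mN N0 QN]]; exists (W @^-1` N); split.
- by rewrite -[X in measurable X]setTI; exact: mW.
- exact: null.
- by move=> w /= nQ; exact: QN.
Qed.

Variables (S : Omega -> R).
Hypotheses (mS : measurable_fun [set: Omega] S) (S01 : forall w, 0 <= S w <= 1).

Section density.
Variable f : R -> R.
Hypothesis f_density : has_density (fun B => P (S @^-1` B)) f.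

Lemma density_ae (Q : R -> Prop) :
  {ae (@lebesgue_measure R), forall u, Q u} -> {ae P, forall w, Q (S w)}.
Proof.
have [mf _ fE] := f_density.
apply: ae_comp => // A mA A0; rewrite fE//; apply: null_set_integral => //.
by apply/measurable_EFinP; exact: measurable_funTS.
Qed.

Lemma density_zero_ae (I : interval R) :
  {ae (@lebesgue_measure R), forall u, u \in I -> f u = 0} ->
  {ae P, forall w, S w \notin I}.
Proof.
have [mf _ fE] := f_density.
move=> fI0; exists (S @^-1` [set` I]); split.
- by rewrite -[X in measurable X]setTI; apply: mS.
- rewrite fE// (@ae_eq_integral _ _ _ _ _ (cst 0%E))//.
  + exact: integral0.
  + by apply/measurable_EFinP; exact: measurable_funTS.
  + by apply: ae_imply fI0 => u fu Iu; rewrite fu.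
- by move=> w /= /negP; rewrite negbK.
Qed.

Lemma density_bounded_lipschitz (c a b : R) :
  {ae (@lebesgue_measure R), forall u, u \in `[0, 1] -> f u <= c} ->
  0 <= c -> a <= b ->
  \int[P]_w (a < S w <= b)%R%:R <= c * (b - a).
Proof.
have [mf f0 fE] := f_density.
move=> fc c0 ab.
have mab : measurable_fun [set: Omega] (fun w => a < S w <= b).
  by apply: measurable_and; [exact: measurable_fun_ltr|exact: measurable_fun_ler].
rewrite Rintegral_indicator//.
have -> : [set w | a < S w <= b] = S @^-1` (`]a, b] `&` `[0, 1]).
  by apply/seteqP; split => [w /= h|w [/= h _]]; rewrite ?in_itv//=; split;
    rewrite /= ?in_itv// in h *.
rewrite fE//; last exact: measurableI.
rewrite -lee_fin fineK; last first.
  rewrite -fE//; last exact: measurableI.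
  rewrite fin_num_measure// -[X in measurable X]setTI; apply: mS => //.
  exact: measurableI.
apply: (@le_trans _ _ (\int[lebesgue_measure]_(u in `]a, b] `&` `[0%R, 1%R]) (cst c%:E u))%E).
  apply: ae_ge0_le_integral => //.
  - exact: measurableI.
  - by move=> u _; rewrite lee_fin.
  - by apply/measurable_EFinP; exact: measurable_funTS.
  - by apply: ae_imply fc => u fu [_ /= u01]; rewrite lee_fin; exact: fu.
rewrite integral_cst; last exact: measurableI.
rewrite EFinM; apply: lee_wpmul2l; first by rewrite lee_fin.
apply: (@le_trans _ _ (lebesgue_measure (`]a, b] : set R))).
  apply: le_measure; rewrite ?inE; last exact: subIsetl.
    exact: measurableI.
  exact: measurable_itv.
rewrite lebesgue_measure_itv/= lte_fin; case: ltP => // ba.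
by rewrite lee_fin subr_ge0.
Qed.

End density.

(** Since V is a function g of S, the functions g and m of S have the same integral
    over every event on S, and therefore agree almost everywhere for the law of
    S.  This requires m to be integrable for that law, which has to be derived: the
    integral of m (S w) over the whole space is that of V, hence finite, and with
    the convention +oo - +oo = -oo only integrable functions have a finite
    integral. *)
Lemma cond_expectation_ae (V : Omega -> R) (g m : R -> R) :
  bounded_mfun V -> measurable_fun (`[0, 1] : set R) g ->
  {ae P, forall w, V w = g (S w)} ->
  cond_expectation_given P (`[0, 1] : set R) S V m ->
  {ae P, forall w, V w = m (S w)}.
Proof.
move=> bV mg Vg [mm condm].
have [mV [M VM]] := bV.
have SD : S @^-1` `[0, 1] = [set: Omega].
  by apply/seteqP; split => // w _ /=; rewrite in_itv/=.
have m01 : measurable (`[0, 1]%classic : set R) by exact: measurable_itv.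
pose m' := m \_ `[0, 1].
(* truncation at the bound of V makes g bounded without changing g (S w) *)
pose g' u := Num.max (- M) (Num.min M ((g \_ `[0, 1]) u)).
have mm' : measurable_fun [set: R] m'.
  exact/(measurable_restrictT _ _).1.
have mg' : measurable_fun [set: R] g'.
  apply: measurable_maxr; first exact: measurable_cst.
  apply: measurable_minr; first exact: measurable_cst.
  exact/(measurable_restrictT _ _).1.
have Sin w : S w \in (`[0, 1]%classic : set R) by rewrite inE /= in_itv/=.
have m'E w : m' (S w) = m (S w) by rewrite /m' patchE Sin.
have bg'S : bounded_mfun (fun w => g' (S w)).
  split; first exact: measurableT_comp.
  exists M => w; rewrite /g' ler_norml le_max lexx/= ge_max ge_min lexx/= andbT.
  by rewrite -subr_ge0 opprK -mulr2n mulrn_wge0// (le_trans _ (VM w)).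
have g'E : {ae P, forall w, V w = g' (S w)}.
  apply: filterS Vg => w Vw; rewrite /g' patchE Sin -Vw.
  have := VM w; rewrite ler_norml => /andP[VM1 VM2].
  by rewrite (min_idPr VM2) (max_idPr VM1).
have im' : P.-integrable [set: Omega] (fun w => (m' (S w))%:E).
  have mm'S : measurable_fun [set: Omega] (fun w => (m' (S w))%:E).
    by apply/measurable_EFinP; exact: measurableT_comp.
  apply/integrableP; split => //; apply/(abse_integralP _ _ _).1 => //.
  rewrite (eq_integral (fun w => (m (S w))%:E)); last by move=> w _; rewrite m'E.
  rewrite -SD -condm// SD -fin_num_abs.
  exact/integrable_fin_num/bounded_mfun_integrable.
pose law : {measure set R -> \bar R} := pushforward P S.
have : ae_eq (law mS) (`[0, 1]%classic : set R) (EFin \o g') (EFin \o m').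
  apply: integral_ae_eq => //.
  - apply: integrable_pushforward => //; first exact/measurable_EFinP.
    by rewrite SD; exact: bounded_mfun_integrable.
  - by apply/measurable_EFinP; exact: measurable_funTS.
  - move=> E E01 mE.
    have mSE : measurable (S @^-1` E) by rewrite -[X in measurable X]setTI; exact: mS.
    rewrite integral_pushforward//; last 2 first.
    + exact/measurable_EFinP.
    + apply: (@integrableS _ _ _ _ setT) => //; exact: bounded_mfun_integrable.
    rewrite integral_pushforward//; last 2 first.
    + exact/measurable_EFinP.
    + exact: (@integrableS _ _ _ _ setT).
    transitivity (\int[P]_(w in S @^-1` E) (V w)%:E)%E.
      apply: ae_eq_integral => //.
      * by apply/measurable_EFinP/measurable_funTS; have [] := bg'S.
      * by apply/measurable_EFinP/measurable_funTS.
      * by apply: filterS g'E => w /= <- _.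
    by rewrite condm//; apply: eq_integral => w _; rewrite /= m'E.
move=> /(@ae_comp _ _ _ S _ mS) => /(_ (fun A _ => id)) g'm'.
apply: filterS2 g'E g'm' => w -> /(_ (S01 w))[->].
by rewrite m'E.
Qed.

End random_score.

Lemma cond_expectation_indicator {dO} {Omega : measurableType dO} {dU}
    {U : measurableType dU} {R : realType} (P : probability Omega R)
    (D B : set U) (S : Omega -> U) (V : Omega -> R) (m : U -> R) :
  cond_expectation_given P D S V m -> measurable B -> B `<=` D ->
  \int[P]_w (V w * (S w \in B)%:R) = \int[P]_w (m (S w) * (S w \in B)%:R).
Proof.
move=> [_ condm] mB BD.
have patchB (h : Omega -> R) :
    \int[P]_w (h w * (S w \in B)%:R) = \int[P]_(w in S @^-1` B) h w.
  rewrite [RHS]Rintegral_mkcond; apply: eq_Rintegral => w _; rewrite patchE.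
  have [SB|SB] := boolP (S w \in B).
    by rewrite mulr1 mem_set//; exact: set_mem.
  by rewrite mulr0 memNset// => BS; move/negP: SB; apply; exact/mem_set.
by rewrite !patchB /Rintegral condm.
Qed.

(** * Limits superior and minima *)

Section limsup.
Context {R : realType}.
Local Open Scope ereal_scope.
Implicit Types u v : (\bar R)^nat.

Lemma le_limn_esup u v :
  (forall e : R, (0 < e)%R -> exists N, forall n, (N <= n)%N -> u n <= v n + e%:E) ->
  limn_esup u <= limn_esup v.
Proof.
move=> uv; rewrite /limn_esup; apply: le_ereal_inf_tmp => _ [V [N0 _ VN0] <-].
apply/lee_addgt0Pr => e e0; have [N uvN] := uv e e0.
apply: (@le_trans _ _ (ereal_sup (u @` [set n | (maxn N N0 <= n)%N]))).
  apply: ereal_inf_lbound; exists [set n | (maxn N N0 <= n)%N] => //.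
  by exists (maxn N N0).
apply: ge_ereal_sup => _ [n /= + <-]; rewrite geq_max => /andP[Nn N0n].
rewrite (le_trans (uvN n Nn))// leeD2r//; apply: ereal_sup_ubound.
by exists n => //; exact: VN0.
Qed.

Lemma limn_esup_le_cst u (l : \bar R) :
  (forall e : R, (0 < e)%R -> exists N, forall n, (N <= n)%N -> u n <= l + e%:E) ->
  limn_esup u <= l.
Proof.
move=> ul; apply: (@le_trans _ _ (limn_esup (fun=> l))); first exact: le_limn_esup.
apply: (@le_trans _ _ (ereal_sup ((fun=> l) @` [set: nat]))).
  apply: ereal_inf_lbound; exists [set: nat] => //; exact: filterT.
by apply: ge_ereal_sup => _ [n _ <-].
Qed.

End limsup.

Lemma min01_attained {R : realType} (L : R -> R) (l : R) :
  minimizes01 L l -> min01 L = L l.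
Proof.
move=> [l01 lmin]; apply/eqP; rewrite eq_le; apply/andP; split.
  apply: ge_inf; last by exists l => //=; rewrite in_itv.
  by exists (L l) => _ [lam /= + <-]; rewrite in_itv/=; exact: lmin.
apply: lb_le_inf; first by exists (L l), l => //=; rewrite in_itv.
by move=> _ [lam /= + <-]; rewrite in_itv/=; exact: lmin.
Qed.

(** * The risk of the calibrated threshold *)

Lemma measurable_unit_cube (R : realType) (d : nat) : measurable (@unit_cube R d).
Proof.
rewrite (_ : @unit_cube R d =
    \bigcap_(i in [set: 'I_d]) ((@tnth d R)^~ i @^-1` `[0, 1]%classic)).
  apply: fin_bigcap_measurable => // i _.
  rewrite -[X in measurable X]setTI; apply: measurable_tnth => //.
by apply/seteqP; split => [x h i _|x h i];
  [rewrite /= in_itv; exact: h|have := h i Logic.I; rewrite /= in_itv].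
Qed.

Theorem theorem5 (R : realType) (d : nat)
  (dO : measure_display) (Omega : measurableType dO) (P : probability Omega R)
  (X : nat -> {RV P >-> d.-tuple R}) (Y : nat -> {RV P >-> bool})
  (eta : d.-tuple R -> R) (pR : R)
  (* the data-generating model; eta x is Pr(Y = 1 | x) *)
  (Xcube : forall i w, unit_cube (X i w))
  (Xunif : forall A : set (d.-tuple R), measurable A ->
    distribution P (X 0%N) A = uniform_cube R d A)
  (eta01 : forall x, unit_cube x -> 0 <= eta x <= 1)
  (eta_cond : cond_expectation_given P (@unit_cube R d) (X 0%N)
    (fun w => (Y 0%N w)%:R) eta)
  (XYiid : iid P (fun i w => (X i w, Y i w)))
  (pR01 : 0 < pR < 1)
  (XR_gt0 : (0 < uniform_cube R d (reliability_set eta pR))%E)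
  (XRC_gt0 : (0 < uniform_cube R d (@unit_cube R d `\` reliability_set eta pR))%E)
  (eta_pR0 : uniform_cube R d [set x | unit_cube x /\ eta x = pR] = 0%E)
  (* the working model *)
  (pi : d.-tuple R -> R)
  (pi_meas : measurable_fun (@unit_cube R d) pi)
  (pi01 : forall x, unit_cube x -> 0 <= pi x <= 1)
  (* assumption (1) *)
  (margin : exists2 c0 : R, 0 < c0 &
    {ae uniform_cube R d, forall x, unit_cube x -> c0 <= `|eta x - pR|})
  (* assumption (2) *)
  (g : R -> R) (g_meas : measurable_fun (`[0, 1] : set R) g)
  (eta_score : {ae uniform_cube R d, forall x, unit_cube x ->
    eta x = g (score pi x)})
  (cm cp : R) (cm_ge0 : 0 <= cm) (cm_le_cp : cm <= cp) (cp_le1 : cp <= 1)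
  (m : R -> R)
  (m_cond : cond_expectation_given P (`[0, 1] : set R) (fun w => score pi (X 0%N w))
    (fun w => eta (X 0%N w)) m)
  (crossing : {ae (@lebesgue_measure R), forall u : R,
    u \in `[0, 1] -> u \notin `[cm, cp] -> 0 < (pR - m u) * (u - cp)})
  (* assumption (3) *)
  (f : R -> R)
  (f_density : has_density
    (fun B => uniform_cube R d (@unit_cube R d `&` score pi @^-1` B)) f)
  (f_cont_left : {within `[0, cm[, continuous f})
  (f_cont_right : {within `]cp, 1], continuous f})
  (f_bounds : exists2 c : R, 0 < c &
    {ae (@lebesgue_measure R), forall u : R,
      u \in `[0, 1] -> u \notin `[cm, cp] -> c^-1 <= f u <= c})
  (f_zero : {ae (@lebesgue_measure R), forall u : R, u \in `[cm, cp] -> f u = 0})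
  (* the thresholds *)
  (alpha : R) (alpha_gt0 : 0 < alpha)
  (lamstar : forall n : nat, n.-tuple (d.-tuple R * bool) -> R)
  (lamstar_meas : forall n : nat, measurable_fun
    [set z : n.-tuple (d.-tuple R * bool) | forall i, unit_cube (tnth z i).1]
    (lamstar n))
  (lamstar_min : forall (n : nat) (z : n.-tuple (d.-tuple R * bool)),
    (forall i, unit_cube (tnth z i).1) ->
    minimizes01 (empirical_loss pR pi z) (lamstar n z)) :
  let L n w := empirical_loss pR pi (calibration X Y n w) in
  let lamdagger n w :=
    lambda_dagger n alpha (L n w) (lamstar n (calibration X Y n w)) in
  (limn_esup (fun n =>
     'E_P[fun w => type1_integrand eta pi pR (lamdagger n w) (X n w) (Y n w)])
   = limn_esup (fun n =>
     'E_P[fun w => (loss pR pi (lamdagger n w) (X n w) (Y n w)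
                   - min01 (fun lam => fine 'E_P[fun w' => L n w' lam]))%R]))%E
  /\
  (limn_esup (fun n =>
     'E_P[fun w => (loss pR pi (lamdagger n w) (X n w) (Y n w)
                   - min01 (fun lam => fine 'E_P[fun w' => L n w' lam]))%R])
   <= alpha%:E)%E.
Proof.
move=> L lamdagger.
have mcube : measurable (@unit_cube R d) by exact: measurable_unit_cube.
have mscore : measurable_fun (@unit_cube R d) (score pi).
  by apply: measurable_funB => //; exact: measurable_cst.
have cubeX i w : X i w \in @unit_cube R d by rewrite inE; exact: Xcube.
(* The model, the success probability and the empirical minimizer are only assumed
   measurable on the cube; modifying them elsewhere affects no observation.  The
   minimum with 1 bounds the modified minimizer off the cube. *)
pose pi' := pi \_ (@unit_cube R d).
have mpi' : measurable_fun [set: d.-tuple R] pi'.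
  exact/(measurable_restrictT _ _).1.
have pi'X i w : pi' (X i w) = pi (X i w) by rewrite /pi' patchE cubeX.
pose eta' := eta \_ (@unit_cube R d).
have [meta _] := eta_cond.
have meta' : measurable_fun [set: d.-tuple R] eta'.
  exact/(measurable_restrictT _ _).1.
have eta'X i w : eta' (X i w) = eta (X i w) by rewrite /eta' patchE cubeX.
pose cubes n := [set z : n.-tuple (d.-tuple R * bool) | forall i, unit_cube (tnth z i).1].
have mcubes n : measurable (cubes n).
  rewrite (_ : cubes n = \bigcap_(i in [set: 'I_n])
      ((fun z : n.-tuple (d.-tuple R * bool) => (tnth z i).1) @^-1` @unit_cube R d)).
    apply: fin_bigcap_measurable => // i _.
    rewrite -[X in measurable X]setTI.
    by apply: (measurableT_comp measurable_fst (@measurable_tnth _ _ n i)).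
  by apply/seteqP; split => [x h i _|x h i]; [exact: h|exact: (h i)].
pose lamstar' n z := Num.min 1 ((@lamstar n \_ (cubes n)) z).
have mlamstar' n : measurable_fun [set: n.-tuple (d.-tuple R * bool)] (@lamstar' n).
  apply: measurable_minr; first exact: measurable_cst.
  by apply/(measurable_restrictT _ (mcubes n)); exact: lamstar_meas.
have lamstar'_le1 n z : @lamstar' n z <= 1 by rewrite ge_min lexx.
pose Z i w := (X i w, Y i w).
have mZ i : measurable_fun [set: Omega] (Z i) by exact: measurable_fun_pair.
have in_cubes n w : cubes n (sample Z n w).
  by move=> i; rewrite tnth_mktuple; exact: Xcube.
have lamstar'E n w : lamstar' n (sample Z n w) = lamstar n (calibration X Y n w).
  rewrite /lamstar' patchE mem_set; last exact: in_cubes.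
  apply/min_idPr.
  by have [/andP[_]] := @lamstar_min n _ (in_cubes n w).
have lossE n w lam : empirical_loss pR pi (calibration X Y n w) lam =
    empirical_loss pR pi' (sample Z n w) lam.
  rewrite /empirical_loss; congr (_ * _); apply: eq_bigr => i _.
  by rewrite !tnth_mktuple /loss /= pi'X.
have lossE' n w : empirical_loss pR pi (calibration X Y n w) =
    empirical_loss pR pi' (sample Z n w).
  by apply/funext => lam; exact: lossE.
have lamstar'_min n w :
    minimizes01 (empirical_loss pR pi' (sample Z n w)) (lamstar' n (sample Z n w)).
  by rewrite lamstar'E -lossE'; apply: lamstar_min; exact: in_cubes.
have lamdaggerE n w : lamdagger n w = dagger Z pR pi' alpha lamstar' n w.
  by rewrite /lamdagger /dagger /L lossE' lamstar'E.
pose S w := score pi (X 0%N w).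
have S'E i w : score pi' (X i w) = score pi (X i w) by rewrite /score pi'X.
have mSi i : measurable_fun [set: Omega] (fun w => score pi (X i w)).
  under eq_fun do rewrite -S'E.
  by apply: (measurableT_comp (measurable_score mpi')).
have mS : measurable_fun [set: Omega] S := mSi 0%N.
have S01 w : 0 <= S w <= 1.
  by have /andP[p0 p1] := pi01 _ (Xcube 0%N w); rewrite /S /score; apply/andP; lra.
have S_density : has_density (fun B => P (S @^-1` B)) f.
  have [mf f0 fE] := f_density; split => // B mB; rewrite -fE// -Xunif.
    rewrite /distribution /pushforward; congr (P _).
    apply/seteqP; split => w /=; last by case.
    by move=> SB; split => //; exact: Xcube.
  exact: mscore.
have [c c_gt0 fc] := f_bounds.
have f_le_c : {ae (@lebesgue_measure R), forall u, u \in `[0, 1] -> f u <= c}.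
  have [N1 [mN1 N10 QN1]] := fc; have [N2 [mN2 N20 QN2]] := f_zero.
  exists (N1 `|` N2); split.
  - exact: measurableU.
  - exact: (etrans (measureU0 mN1 mN2 N20) N10).
  - move=> u /= nfu; have [uI|uI] := boolP (u \in `[cm, cp]).
      right; apply: QN2 => /= fu; apply: nfu => u01.
      by rewrite fu// ltW.
    left; apply: QN1 => /= fu; apply: nfu => u01.
    by have /andP[] := fu u01 uI.
have lip : lipschitz_law P Z (fun t => score pi' t.1) c.
  move=> a b _ ab; under eq_Rintegral do rewrite /= S'E.
  by apply: (density_bounded_lipschitz mS S01 S_density) => //; exact: ltW.
pose V w := eta (X 0%N w).
have bV : bounded_mfun V.
  split; last first.
    by exists 1 => w; have /andP[e0 e1] := eta01 _ (Xcube 0%N w); rewrite ger0_norm.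
  by rewrite /V; under eq_fun do rewrite -eta'X; exact: measurableT_comp.
have Vg : {ae P, forall w, V w = g (S w)}.
  have : {ae P, forall w, unit_cube (X 0%N w) -> V w = g (S w)}.
    apply: (@ae_comp _ _ _ P _ _ (uniform_cube R d) (X 0%N)
      (fun x => unit_cube x -> eta x = g (score pi x))) => // A mA A0.
    by rewrite -[LHS]/(distribution P (X 0%N) A) Xunif.
  by apply: ae_imply => w h; exact/h/Xcube.
have Vm : {ae P, forall w, V w = m (S w)}.
  exact: (cond_expectation_ae mS S01 bV g_meas Vg m_cond).
have sign : {ae P, forall w, 0 < (pR - V w) * (S w - cp)}.
  have h1 := density_ae mS S_density crossing.
  have h2 := density_zero_ae mS S_density f_zero.
  apply: filterS3 Vm h1 h2 => w -> cr /cr; apply; rewrite in_itv; exact: S01.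
have [mean_decr mean_incr] : (forall lam1 lam2, lam1 <= lam2 -> lam2 <= cp ->
      mean_gain P Z pR pi' lam2 <= mean_gain P Z pR pi' lam1) /\
    (forall lam1 lam2, cp <= lam1 -> lam1 <= lam2 ->
      mean_gain P Z pR pi' lam1 <= mean_gain P Z pR pi' lam2).
  apply: (mean_gain_crossing mZ mpi' bV).
    move=> a b /=; pose B := @unit_cube R d `&` score pi @^-1` `]a, b].
    have BJ w : (X 0%N w \in B) = (a < score pi' (X 0%N w) <= b).
      rewrite S'E; apply/idP/idP => [|h]; first by rewrite inE /B /= in_itv/= => -[].
      by rewrite inE /B /= in_itv/=; split => //; exact: Xcube.
    have mB : measurable B by exact: mscore.
    have := cond_expectation_indicator eta_cond mB (@subIsetl _ _ _).
    under eq_Rintegral do rewrite BJ.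
    by under [in X in _ = X]eq_Rintegral do rewrite BJ.
  by apply: ae_imply sign => w; rewrite /= S'E.
have cp01 : 0 <= cp <= 1 by rewrite (le_trans cm_ge0)// cp_le1.
have asymptotics := dagger_gain_asymptotics mZ XYiid pR01 mpi' lip alpha_gt0 cp01
  mlamstar' lamstar'_le1 lamstar'_min mean_decr mean_incr.
have min_mean_loss n : (0 < n)%N ->
    min01 (fun lam => fine ('E_P[fun w' => L n w' lam])%E) =
    (1 - pR) + mean_gain P Z pR pi' cp.
  move=> n0; rewrite (_ : (fun lam => _) = fun lam =>
    (1 - pR) + mean_gain P Z pR pi' lam); last first.
    apply/funext => lam; under eq_fun do rewrite /L lossE.
    by rewrite (mean_empirical_loss mZ XYiid pR mpi').
  apply: (min01_attained (l := cp)); split => // lam _; rewrite lerD2l.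
  exact: (mean_gain_min mean_decr mean_incr).
have bc (k : R) := @bounded_mfun_cst _ Omega R k.
pose dag := dagger Z pR pi' alpha lamstar'.
have mdag n : (0 < n)%N -> measurable_fun [set: Omega] (dag n).
  exact: measurable_dagger.
have bgain n (lam : Omega -> R) : measurable_fun [set: Omega] lam ->
    bounded_mfun (fun w => gain pR pi' (lam w) (Z n w)).
  exact: gain_sample_bounded.
pose E2 n := \int[P]_w gain pR pi' (dag n w) (Z n w).
pose E1 n := \int[P]_w gain pR pi' (Num.min cp (dag n w)) (Z n w).
have excessE n : (0 < n)%N ->
    ('E_P[fun w => (loss pR pi (lamdagger n w) (X n w) (Y n w)
       - min01 (fun lam => fine 'E_P[fun w' => L n w' lam]))%R])%E =
    (E2 n - mean_gain P Z pR pi' cp)%:E.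
  move=> n0; rewrite (_ : (fun w => _) = fun w =>
    gain pR pi' (dag n w) (Z n w) - mean_gain P Z pR pi' cp); last first.
    apply/funext => w; rewrite min_mean_loss// lamdaggerE.
    rewrite (_ : loss pR pi _ _ _ = loss pR pi' (dag n w) (Z n w).1 (Z n w).2).
      by rewrite loss_gain; ring.
    by rewrite /loss /= pi'X.
  have bg := bgain n _ (mdag n n0).
  rewrite expectation_Rintegral; last exact: bounded_mfunB.
  rewrite RintegralB//; try exact: bounded_mfun_integrable.
  by rewrite Rintegral_probability_cst.
(* the sign condition is transferred from the first observation to the test one *)
have sign_n n : {ae P, forall w, (eta (X n w) < pR) = (cp < score pi' (X n w))}.
  pose b (t : d.-tuple R * bool) := (eta' t.1 < pR) == (cp < score pi' t.1).
  have mb : measurable_fun [set: d.-tuple R * bool] b.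
    have mlt : measurable_fun [set: d.-tuple R * bool] (fun t => eta' t.1 < pR).
      by apply: measurable_fun_ltr => //; exact: (measurableT_comp meta').
    have mgt : measurable_fun [set: d.-tuple R * bool] (fun t => cp < score pi' t.1).
      apply: measurable_fun_ltr => //.
      by apply: (measurableT_comp (measurable_score mpi')).
    rewrite (_ : b = fun t => if eta' t.1 < pR then cp < score pi' t.1
      else ~~ (cp < score pi' t.1)).
      by apply: measurable_fun_ifT => //; exact: measurable_neg.
    by apply/funext => t; rewrite /b; case: (_ < pR); case: (_ < _).
  have : {ae P, forall w, b (Z n w)}.
    apply: (iid_ae mZ XYiid n mb); apply: ae_imply sign => w; rewrite /b /= eta'X S'E.
    rewrite -/(V w) -/(S w).
    by have [Vp|Vp] := ltP (V w) pR; have [Sc|Sc] := ltP cp (S w) => //; nra.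
  by apply: ae_imply => w /eqP; rewrite /= eta'X.
have type1E n : (0 < n)%N ->
    ('E_P[fun w => type1_integrand eta pi pR (lamdagger n w) (X n w) (Y n w)])%E =
    (E2 n - E1 n)%:E.
  move=> n0; have mdagn := mdag n n0.
  have mmin : measurable_fun [set: Omega] (fun w => Num.min cp (dag n w)).
    by apply: measurable_minr => //; exact: measurable_cst.
  rewrite (_ : (fun w => _) = fun w =>
      type1_integrand eta pi' pR (dag n w) (Z n w).1 (Z n w).2); last first.
    by apply/funext => w; rewrite !type1_integrandE//= S'E lamdaggerE.
  have bh : bounded_mfun (fun w =>
      type1_integrand eta pi' pR (dag n w) (Z n w).1 (Z n w).2).
    under eq_fun => w do rewrite (type1_integrandE _ _ _ _ _ (Xcube n w)).
    apply: bounded_mfunM.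
      by apply: bounded_mfunB => //; exact: bounded_mfun_bool.
    apply: bounded_mfun_bool; apply: measurable_and.
      apply: measurable_fun_ler => //.
      by apply: (measurableT_comp (measurable_score mpi')).
    apply: measurable_fun_ltr => //; under eq_fun do rewrite -eta'X.
    exact: (measurableT_comp meta').
  rewrite expectation_Rintegral//; congr (_%:E).
  have b2 := bgain n _ mdagn; have b1 := bgain n _ mmin.
  rewrite /E2 /E1 -RintegralB//; try exact: bounded_mfun_integrable.
  apply: Rintegral_ae_eq => //; first exact: bounded_mfunB.
  apply: ae_imply (sign_n n) => w sw.
  apply: (@type1_integrand_gain R d pR pi' eta cp (dag n w) (Z n w)) => //.
  exact: Xcube.
have asymp e : 0 < e -> exists N, forall n, (N <= n)%N ->
    [/\ (0 < n)%N, E2 n - mean_gain P Z pR pi' cp <= alpha + e,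
      0 <= E1 n - mean_gain P Z pR pi' cp & E1 n - mean_gain P Z pR pi' cp <= e].
  move=> e0; have [N NP] := asymptotics e e0; exists (maxn N 1) => n.
  by rewrite geq_max => /andP[/NP[]].
split; last first.
  apply: limn_esup_le_cst => e /asymp[N NP]; exists N => n /NP[n0 h _ _].
  by rewrite excessE// lee_fin.
apply/eqP; rewrite eq_le; apply/andP; split; apply: le_limn_esup => e /asymp[N NP];
  by exists N => n /NP[n0 _ h1 h2]; rewrite type1E// excessE// -EFinD lee_fin; lra.
Qed.
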